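(* Let $\Omega_1\subset\mathbb{R}^2$ be a bounded simply connected region whose boundary is parametrized, with positive (counterclockwise) orientation, by a piecewise smooth simple closed curve $\gamma=(x,y)\colon[0,T]\to\mathbb{R}^2$ with $\gamma(0)=\gamma(T)=(0,0)$, and let $A=\operatorname{area}(\Omega_1)$. Fix $\theta_0\in\mathbb{R}$. For each $l>0$ let $\theta_l\colon[0,T]\to\mathbb{R}$ be the (continuous, piecewise $C^1$) solution of $$\dot\theta_l(t)=\frac1l\bigl(\sin\theta_l(t)\,\dot x(t)-\cos\theta_l(t)\,\dot y(t)\bigr),\qquad \theta_l(0)=\theta_0,$$ and put $\Delta\theta(l)=\theta_l(T)-\theta_l(0)$. Then, as $l\to\infty$ with $\gamma$ and $\theta_0$ fixed, $$\Delta\theta(l)=\frac{A}{l^2}+\mathcal{O}\!\left(\frac1{l^3}\right),\qquad\text{equivalently}\qquad A=l^2\,\Delta\theta(l)+\mathcal{O}\!\left(\frac1l\right).$$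
   Context: The Prytz planimeter is a rigid rod of length $l$ with tracer end $p=(x,y)\in\mathbb{R}^2$ and chisel end $q=(x+l\cos\theta,\,y+l\sin\theta)$. When the tracer end follows a curve, the chisel end moves subject to the nonholonomic constraint that $\dot q$ is parallel to $q-p$, which is equivalent to $-\sin\theta\,\dot x+\cos\theta\,\dot y+l\dot\theta=0$, i.e. to the displayed differential equation. The quantity $l^2\Delta\theta$ is the ''Prytz area'' measured by the planimeter. At the finitely many points where $\gamma$ is not differentiable, the differential equation is not required to hold. *)

(* Defs.v *)
From mathcomp Require Import all_boot all_order all_algebra.
From mathcomp Require Import all_classical all_reals all_analysis.
Set Implicit Arguments.
Unset Strict Implicit.
Unset Printing Implicit Defensive.
Import Order.TTheory GRing.Theory Num.Theory.
Import numFieldNormedType.Exports.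
Local Open Scope classical_set_scope.
Local Open Scope ring_scope.

(* [f] is C^1 on the closed interval [a, b]: the derivative on the open interval
   extends continuously to [a, b]. Values outside [a, b] play no role. *)
Definition C1_on (R : realType) (a b : R) (f : R -> R) : Prop :=
  {within `[a, b], continuous f} /\
  exists g : R -> R, {within `[a, b], continuous g} /\
    forall t, a < t < b -> is_derive t 1 f (g t).

(* Consecutive closed pieces share a breakpoint, so [f] is continuous on [a, b]. *)
Definition piecewise_C1 (R : realType) (a b : R) (f : R -> R) : Prop :=
  exists (n : nat) (s : nat -> R), [/\ s 0%N = a, s n = b,
    (forall i, (i < n)%N -> s i < s i.+1) &
    forall i, (i < n)%N -> C1_on (s i) (s i.+1) f].

Definition curve (R : realType) (x y : R -> R) : R -> R * R :=
  fun t => (x t, y t).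

Definition piecewise_smooth_simple_closed (R : realType) (T : R)
    (x y : R -> R) : Prop :=
  [/\ piecewise_C1 0 T x, piecewise_C1 0 T y,
    curve x y 0 = curve x y T &
    forall s t, 0 <= s < T -> 0 <= t < T -> curve x y s = curve x y t -> s = t].

Definition path_in (R : realType) (U : set (R * R)) (c : R -> R * R) : Prop :=
  {within `[0, 1], continuous c} /\ forall s, 0 <= s <= 1 -> U (c s).

Definition null_homotopic_in (R : realType) (U : set (R * R))
    (c : R -> R * R) : Prop :=
  exists H : R * R -> R * R,
    [/\ {within `[0, 1] `*` `[0, 1], continuous H},
      (forall u s, 0 <= u <= 1 -> 0 <= s <= 1 -> U (H (u, s))),
      (forall s, 0 <= s <= 1 -> H (0, s) = c s),
      (forall s, 0 <= s <= 1 -> H (1, s) = c 0) &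
      forall u, 0 <= u <= 1 -> H (u, 0) = c 0 /\ H (u, 1) = c 0].

Definition simply_connected (R : realType) (U : set (R * R)) : Prop :=
  (forall p q, U p -> U q -> exists c, [/\ path_in U c, c 0 = p & c 1 = q]) /\
  (forall c, path_in U c -> c 0 = c 1 -> null_homotopic_in U c).

Definition region (R : realType) (U : set (R * R)) : Prop :=
  [/\ open U, connected U & U !=set0].

Definition boundary (R : realType) (U : set (R * R)) : set (R * R) :=
  closure U `\` interior U.

(* Positive orientation: [U] lies to the left of the curve, i.e. the left normal
   (-y', x') points into [U] wherever the curve has a nonzero tangent. *)
Definition positively_oriented (R : realType) (T : R) (x y : R -> R)
    (U : set (R * R)) : Prop :=
  forall t, 0 < t < T -> derivable x t 1 -> derivable y t 1 ->
    (derive1 x t, derive1 y t) != (0, 0) ->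
    \forall e \near 0^'+, U (x t - e * derive1 y t, y t + e * derive1 x t).

Definition area (R : realType) (U : set (R * R)) : R :=
  fine ((@lebesgue_measure R \x @lebesgue_measure R)%E U).

(* [theta] is the heading of a Prytz planimeter of length [l] whose tracer end
   follows (x, y) on [0, T], with initial heading [theta0]. *)
Definition prytz_solution (R : realType) (T : R) (x y : R -> R) (theta0 l : R)
    (theta : R -> R) : Prop :=
  [/\ piecewise_C1 0 T theta, theta 0 = theta0 &
    forall t, 0 < t < T -> derivable x t 1 -> derivable y t 1 ->
      is_derive t 1 theta
        (l^-1 * (sin (theta t) * derive1 x t - cos (theta t) * derive1 y t))].

(* The Landau notations find the filter structure of [+oo] through this instance. *)
Canonical pinfty_filter_on (R : realType) : filter_on R :=
  FilterType (pinfty_nbhs R) (@filter_filter _ _ (@proper_pinfty_nbhs R)).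

(* Main.v *)
From HB Require Import structures.
Require Import Defs.
From mathcomp Require Import all_boot all_order all_algebra.
From mathcomp Require Import all_classical all_reals all_analysis.
From mathcomp Require Import measurable_realfun ring lra.
Import Order.TTheory GRing.Theory Num.Theory.
Import numFieldNormedType.Exports.
Local Open Scope classical_set_scope.
Local Open Scope ring_scope.
Set Implicit Arguments.
Unset Strict Implicit.
Unset Printing Implicit Defensive.

(** Green's formula [area Omega = \int x dy] is obtained from a winding number.
    Instead of the full angle around a base point [p] we use an angle that only
    varies inside the sector [|v| <= u] to the right of [p] (coordinates
    [(u, v)] relative to [p]).  Its differential is bounded by a kernel that is
    integrable in [p], and its integral over [p] in a box is exactly
    [(x + M) dy]; so Fubini turns the integral of the winding number over the
    box into the line integral of [x dy].

    It remains to see that the winding number is the indicator of [Omega]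
    almost everywhere.  By Sard almost every horizontal line meets the curve
    only at interior points of the pieces with [y' != 0].  Along such a line
    both functions are locally constant off the curve and vanish far to the
    right.  At a crossing the left normal points into [Omega], and the winding
    number jumps by one; since it is constant on the connected set [Omega], the
    other side of the curve cannot belong to [Omega], so the indicator makes
    the same jump.  No Jordan curve theorem is needed.

    The expansion of the planimeter equation is the second order Taylor
    expansion in [1 / l]: the first order term integrates to zero on a closed
    curve, and the second order one is an exact form plus [x dy]. *)

(** * Calculus on the real line *)

(** The sector is weighted by an even density of mass one. Along a vertical line of base points to
    the left of a curve point the form integrates to exactly [dy], its [dx] part being odd; along a
    line to the right it vanishes. The abscissas in [[-M, x[] have total length [x + M], and the
    term [M dy] disappears around a closed curve. The box has half-height [3 * M] so that no sector
    is truncated.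

    The indicator and the winding number are compared through their difference on a horizontal line.
    At a point of the curve it is replaced by its common value on both sides. The resulting function
    is locally constant at every abscissa, hence constant, so the crossings are neither ordered nor
    counted. The orientation hypothesis concerns the normal direction, while crossings are studied
    along a horizontal line; a short vertical segment that misses the curve leads from one to the
    other.

    One-sided derivatives at breakpoints are avoided by replacing each piece of the curve by
    functions on the whole line that have two-sided derivatives on the closed piece. *)

Section calculus.
Context {R : realType}.
Implicit Types (f g F G : R -> R) (a b t d : R).

Lemma is_derive_local f g t d (r : R) : 0 < r ->
  (forall s, `|s - t| < r -> f s = g s) -> is_derive t 1 g d -> is_derive t 1 f d.
Proof.
move=> r0 fg; apply: near_eq_is_derive.
near=> s; apply/esym/fg; rewrite distrC.
by near: s; exact: (@nbhsx_ballx _ _ t r r0).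
Unshelve. all: by end_near. Qed.

Lemma is_derive_approx f t d : is_derive t 1 f d -> forall e, 0 < e ->
  exists2 r, 0 < r & forall s, `|s - t| < r ->
    `|f s - f t - d * (s - t)| <= e * `|s - t|.
Proof.
move=> /is_derive1_caratheodory [h [hE ch <-]] e e0.
have /cvgrPdist_le /(_ e e0) /nbhs_ballP [r /= r0 H] := ch.
exists r => // s st; rewrite hE -mulrBl normrM ler_wpM2r// distrC.
by apply: H; rewrite /ball/= distrC.
Qed.

(** Serves at the junctions of functions defined by cases, where no single formula holds around [t]
    but every branch touches the tangent to second order. *)
Lemma is_derive_quadratic f t d (C : R) :
  (forall s, `|f s - f t - d * (s - t)| <= C * (s - t) ^+ 2) ->
  is_derive t 1 f d.
Proof.
move=> H; apply/is_derive1_caratheodory.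
exists (fun s => if s == t then d else (f s - f t) / (s - t)); split.
- move=> s; case: eqVneq => [->|st]; first by rewrite !subrr mulr0.
  by rewrite divfK// subr_eq0.
- have C0 : 0 <= C by have := H (1 + t); rewrite addrK expr1n !mulr1; apply: (le_trans (normr_ge0 _)).
  apply/cvgrPdist_le => /= e e0; rewrite eqxx; near=> s.
  case: eqVneq => [_|st]; first by rewrite subrr normr0 ltW.
  have st' : s - t != 0 by rewrite subr_eq0.
  rewrite distrC (_ : _ - d = (f s - f t - d * (s - t)) / (s - t)); last by field.
  rewrite normrM normfV ler_pdivrMr ?normr_gt0//.
  apply: le_trans (H s) _; rewrite -real_normK ?num_real// expr2 mulrA.
  rewrite ler_wpM2r//.
  have : `|s - t| < e / (C + 1).
    rewrite distrC; near: s.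
    by apply: (@nbhsx_ballx _ _ t (e / (C + 1))); rewrite divr_gt0// ltr_wpDl.
  move=> /ltW; rewrite ler_pdivlMr ?ltr_wpDl// mulrC => /(le_trans _); apply.
  by rewrite ler_wpM2r// lerDl.
- by rewrite eqxx.
Unshelve. all: by end_near. Qed.

Lemma is_derive_continuous f t d : is_derive t 1 f d -> {for t, continuous f}.
Proof.
by case=> df _; apply: differentiable_continuous; exact/derivable1_diffP.
Qed.

Lemma bounded_derive_increment f a b (K : R) : a <= b ->
  {within `[a, b], continuous f} ->
  (forall t, a < t < b -> exists2 d, is_derive t 1 f d & `|d| <= K) ->
  `|f b - f a| <= K * (b - a).
Proof.
rewrite le_eqVlt => /predU1P[->|ab] cf H; first by rewrite !subrr normr0 mulr0.
have dfE t : t \in `]a, b[ -> is_derive t 1 f (derive1 f t).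
  by rewrite in_itv/= => /H[d [df _] _]; rewrite derive1E; split.
have [c cab ->] := MVT ab dfE cf.
rewrite normrM (@gtr0_norm _ (b - a)) ?subr_gt0// ler_wpM2r//.
  by rewrite subr_ge0 ltW.
move: cab; rewrite in_itv/= => /H[d [df dE] dK].
rewrite derive1E dE. exact: dK.
Qed.

Lemma Rintegral_derive F f a b : a <= b ->
  {within `[a, b], continuous f} ->
  (forall t, a <= t <= b -> is_derive t 1 F (f t)) ->
  (\int[lebesgue_measure]_(t in `[a, b]) f t = F b - F a)%R.
Proof.
rewrite le_eqVlt => /predU1P[->|ab] cf dF.
  by rewrite set_itv1 Rintegral_set1 subrr.
rewrite /Rintegral (@continuous_FTC2 _ f F)//.
- split=> [t| |].
  + by rewrite in_itv/= => /andP[/ltW ta /ltW tb]; have [] := dF t; rewrite ?ta.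
  + apply: cvg_at_right_filter; apply: is_derive_continuous (dF a _).
    by rewrite lexx ltW.
  + apply: cvg_at_left_filter; apply: is_derive_continuous (dF b _).
    by rewrite lexx ltW.
- move=> t; rewrite in_itv/= => /andP[/ltW ta /ltW tb].
  by rewrite derive1E; have [] := dF t; rewrite ?ta.
Qed.

Lemma locally_constant_cst f :
  (forall t, exists2 r, 0 < r & forall s, `|s - t| < r -> f s = f t) ->
  forall s t, f s = f t.
Proof.
move=> H s t; apply: (@is_derive_0_is_cst _ f) => u.
have [r r0 Hr] := H u; exact: is_derive_local r0 Hr (is_derive_cst _ _ _).
Qed.

End calculus.

(** * Replacing a C^1 piece by functions on the whole line *)

Section extension.
Context {R : realType}.
Implicit Types (f g F G : R -> R) (a b t d : R).

Lemma within_continuous_bounded f a b : a <= b ->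
  {within `[a, b], continuous f} ->
  exists2 M, 0 < M & forall t, a <= t <= b -> `|f t| <= M.
Proof.
move=> ab cf; have [c _ Hc] := EVT_max ab cf; have [d _ Hd] := EVT_min ab cf.
exists (`|f c| + `|f d| + 1) => [|t tab]; first by rewrite ltr_wpDl// addr_ge0.
have tab' : t \in `[a, b] by rewrite in_itv.
move: (Hc _ tab') (Hd _ tab') => fc fd.
have := ler_norm (f c); have := ler_norm (- f d); have := normr_ge0 (f c).
have := normr_ge0 (f d); rewrite normrN ler_norml => *.
by apply/andP; split; lra.
Qed.

Lemma continuous_extension f a b : a <= b ->
  {within `[a, b], continuous f} ->
  exists2 g, continuous g & forall t, a <= t <= b -> g t = f t.
Proof.
move=> ab cf; have [M M0 fM] := within_continuous_bounded ab cf.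
have cl : closed (`[a, b] : set R) by exact: interval_closed.
have [|g [fg cg _]] := continuous_bounded_extension (@pseudometric_normal R R) cl M0 cf.
  by move=> t /=; rewrite in_itv/=; exact: fM.
by exists g => // t tab; rewrite -fg// inE/= in_itv.
Qed.

Lemma continuous_primitive G a b : a <= b -> continuous G ->
  exists2 F, continuous F & forall t, a <= t <= b -> is_derive t 1 F (G t).
Proof.
(* Integrating from [a - 1], and up to [b + 1], makes [a] and [b] interior points, so that the
   derivative there is two-sided. *)
move=> ab cG; pose I t := \int[lebesgue_measure]_(u in `[a - 1, t]) G u.
have ab1 : a - 1 <= b + 1 by lra.
have iG : lebesgue_measure.-integrable `[a - 1, b + 1] (EFin \o G).
  apply: continuous_compact_integrable; first exact: segment_compact.
  exact: continuous_subspaceT.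
have cI : {within `[a - 1, b + 1], continuous I}.
  exact: parameterized_integral_continuous.
have [F0 cF0 F0E] := continuous_extension ab1 cI.
exists F0 => // t /andP[ta tb].
have [||dI IE] := @continuous_FTC1_closed R G (a - 1) t (b + 1) _ iG _ (cG t); [lra..|].
apply: (@is_derive_local _ _ I _ _ 1) => //; last by rewrite derive1E in IE; split.
move=> s; rewrite ltr_distl => /andP[? ?]; apply: F0E; apply/andP; split; lra.
Qed.

(** [C1_on] controls the derivative inside the interval only. A primitive of a continuous extension
    of that derivative has two-sided derivatives at [a] and [b] too, and it differs from [f] by a
    constant on the segment, because the difference has derivative 0 inside. *)
Lemma C1_extension f a b : a < b -> C1_on a b f ->
  exists F G, [/\ continuous F, continuous G,
    forall t, a <= t <= b -> is_derive t 1 F (G t) &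
    forall t, a <= t <= b -> F t = f t].
Proof.
move=> ab [cf [g [cg dg]]].
have [G cG GE] := continuous_extension (ltW ab) cg.
have [F0 cF0 dF0] := continuous_primitive (ltW ab) cG.
exists (fun t => F0 t + (f a - F0 a)), G; split => //.
- by move=> t; apply: cvgD; [exact: cF0|exact: cvg_cst].
- move=> t tab; have /= := dF0 t tab => d.
  by apply: is_derive_eq; rewrite addr0.
move=> t /andP[ta tb].
suff : `|(fun s => F0 s - f s) t - (fun s => F0 s - f s) a| <= 0 * (t - a).
  rewrite mul0r normr_le0 => /eqP /= H; lra.
apply: (@bounded_derive_increment _ (fun s => F0 s - f s)) => //.
  move=> s; apply: cvgB.
    by have /= := (continuous_subspaceT cF0); exact.
  by apply: continuous_subspaceW cf _; apply: subset_itvl; rewrite bnd_simp.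
move=> s /andP[sa st]; exists 0; last by rewrite normr0.
have d1 : is_derive s 1 F0 (G s) by apply: dF0; rewrite !ltW//; exact: lt_le_trans tb.
have d2 : is_derive s 1 f (g s) by apply: dg; rewrite sa/=; exact: lt_le_trans tb.
apply: is_derive_eq; rewrite GE ?subrr//.
by rewrite !ltW//; exact: lt_le_trans tb.
Qed.

End extension.

(** * Common refinement of two subdivisions *)

Section chains.
Context {R : realType}.
Implicit Types (P Q : R -> R -> Prop) (a b : R).

(** For [P c d := C1_on c d f] this unfolds to [piecewise_C1 a b f], to which [chain_meet] therefore
    applies directly. *)
Definition chain P a b := exists (n : nat) (s : nat -> R),
  [/\ s 0%N = a, s n = b, forall i, (i < n)%N -> s i < s i.+1 &
    forall i, (i < n)%N -> P (s i) (s i.+1)].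

Lemma chain_cons P a c b : a < c -> P a c -> chain P c b -> chain P a b.
Proof.
move=> ac Pac [n [s [s0 sn si Ps]]].
exists n.+1, (fun i => if i is j.+1 then s j else a); split => //.
- by move=> [_|i]; rewrite ?s0// ltnS; exact: si.
- by move=> [_|i]; rewrite ?s0// ltnS; exact: Ps.
Qed.

(** Two increasing lists of breakpoints are merged: the smaller of the two first breakpoints closes
    the first common piece, and heredity of [P] or [Q] cuts the longer piece there. *)
Lemma chain_meet P Q a b :
  (forall c d c' d', P c d -> c <= c' -> c' < d' -> d' <= d -> P c' d') ->
  (forall c d c' d', Q c d -> c <= c' -> c' < d' -> d' <= d -> Q c' d') ->
  chain P a b -> chain Q a b -> chain (fun c d => P c d /\ Q c d) a b.
Proof.
move=> hP hQ [n [s [s0 sn si Ps]]] [m [r [r0 rm ri Qr]]].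
(* The longer first piece survives in shortened form, so only one of [n] and [m] is sure to drop;
   hence an induction on a bound of their sum. *)
move: {2}(n + m)%N (leqnn (n + m)) => N.
elim: N a n s s0 sn si Ps m r r0 rm ri Qr => [|N IH] a [|n] s s0 sn si Ps m r r0 rm ri Qr //.
1,2: by move=> _; exists 0%N, (fun=> a); split => //; rewrite -sn.
case: m r r0 rm ri Qr => [|m] r r0 rm ri Qr.
  by move=> _; exists 0%N, (fun=> a); split => //; rewrite -rm.
rewrite addSn ltnS addnS => nmN.
have s01 : a < s 1%N by rewrite -s0 si.
have r01 : a < r 1%N by rewrite -r0 ri.
have Ps0 : P a (s 1%N) by rewrite -s0; exact: Ps.
have Qr0 : Q a (r 1%N) by rewrite -r0; exact: Qr.
have [sr|rs|sr] := ltgtP (s 1%N) (r 1%N).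
- apply: (@chain_cons _ _ (s 1%N)) => //.
    by split => //; apply: hQ Qr0 _ _ _ => //; exact: ltW.
  apply: (IH (s 1%N) n (fun i => s i.+1) _ _ _ _ m.+1
      (fun i => if i is j.+1 then r j.+1 else s 1%N)) => //.
  + by move=> i; exact: (si i.+1).
  + by move=> i; exact: (Ps i.+1).
  + by move=> [_|i] //; exact: (ri i.+1).
  + move=> [_|i]; last exact: (Qr i.+1).
    by apply: hQ Qr0 _ _ _ => //; exact: ltW.
  + by rewrite addnS.
- apply: (@chain_cons _ _ (r 1%N)) => //.
    by split => //; apply: hP Ps0 _ _ _ => //; exact: ltW.
  apply: (IH (r 1%N) n.+1 (fun i => if i is j.+1 then s j.+1 else r 1%N)
      _ _ _ _ m (fun i => r i.+1)) => //.
  + by move=> [_|i] //; exact: (si i.+1).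
  + move=> [_|i]; last exact: (Ps i.+1).
    by apply: hP Ps0 _ _ _ => //; exact: ltW.
  + by move=> i; exact: (ri i.+1).
  + by move=> i; exact: (Qr i.+1).
- apply: (@chain_cons _ _ (s 1%N)) => //.
    by split => //; rewrite sr.
  apply: (IH (s 1%N) n (fun i => s i.+1) _ _ _ _ m (fun i => r i.+1)) => //.
  + by move=> i; exact: (si i.+1).
  + by move=> i; exact: (Ps i.+1).
  + by move=> i; exact: (ri i.+1).
  + by move=> i; exact: (Qr i.+1).
  + exact: ltnW.
Qed.

Lemma C1_onW (f : R -> R) c d c' d' :
  C1_on c d f -> c <= c' -> c' < d' -> d' <= d -> C1_on c' d' f.
Proof.
move=> [cf [g [cg dg]]] cc' cd' dd'.
have sub : `[c', d'] `<=` `[c, d] by apply: subset_itv; rewrite bnd_simp.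
split; first exact: continuous_subspaceW cf.
exists g; split; first exact: continuous_subspaceW cg.
by move=> t /andP[ct td]; apply: dg; rewrite (le_lt_trans cc')//= (lt_le_trans td).
Qed.

Lemma piecewise_C1_meet (a b : R) (x y : R -> R) :
  piecewise_C1 a b x -> piecewise_C1 a b y ->
  chain (fun c d => C1_on c d x /\ C1_on c d y) a b.
Proof. by move=> cx cy; apply: chain_meet => // c d c' d'; exact: C1_onW. Qed.

End chains.

(** * The sector form *)

Section kernel.
Context {R : realType}.
Implicit Types (s t u v : R) (X Y : R -> R).

(** The Epanechnikov density: even, supported in [-1, 1], of integral 1. [ramp] is its distribution
    function. Being polynomial on its support, it has explicit primitives. *)
Definition profile s : R := 3 / 4 * Num.max 0 (1 - s ^+ 2).

Definition ramp s : R :=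
  if s <= -1 then 0 else if 1 <= s then 1 else (2 + 3 * s - s ^+ 3) / 4.

Lemma profile_ge0 s : 0 <= profile s.
Proof. by rewrite mulr_ge0// le_max lexx. Qed.

Lemma profile_out s : 1 <= `|s| -> profile s = 0.
Proof.
move=> s1; rewrite /profile (max_idPl _) ?mulr0// subr_le0 -real_normK ?num_real//.
exact: exprn_ege1.
Qed.

Lemma profile_continuous : continuous profile.
Proof.
move=> s; apply: cvgM; first exact: cvg_cst.
have := @continuous_max R R (cst 0) (fun s => 1 - s ^+ 2) s; apply.
  exact: cvg_cst.
by apply: cvgB; [exact: cvg_cst | exact: exprn_continuous].
Qed.

Lemma ramp_out s : 1 <= `|s| -> ramp s = (0 < s)%R%:R.
Proof.
rewrite /ramp ler_normr => /orP[s1|s1].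
  by rewrite s1 (_ : (0 < s) = true); [case: ifP => //; lra|lra].
by rewrite ifT; [rewrite ltNge (_ : (s <= 0) = true)//|]; lra.
Qed.

Lemma ramp_mid s : -1 <= s <= 1 -> ramp s = (2 + 3 * s - s ^+ 3) / 4.
Proof.
move=> /andP[s1 s2]; rewrite /ramp; case: ifPn => s3.
  have -> : s = -1 by lra.
  by rewrite -signr_odd /=; lra.
case: ifPn => s4 //; have -> : s = 1 by lra.
by rewrite expr1n; lra.
Qed.

Lemma profile_mid s : -1 <= s <= 1 -> profile s = 3 / 4 * (1 - s ^+ 2).
Proof.
move=> /andP[s1 s2]; have h : 0 <= 1 - s ^+ 2 by nra.
by rewrite /profile (max_idPr h).
Qed.

Lemma ramp_derive s : is_derive s 1 ramp (profile s).
Proof.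
have [s1|s1|s1] := ltgtP `|s| 1.
- have s1' := s1; move: s1; rewrite ltr_norml => /andP[s1 s2].
  rewrite profile_mid; last by rewrite !ltW.
  apply: (@is_derive_local _ _ (fun r => (2 + 3 * r - r ^+ 3) / 4) _ _ (1 - `|s|)).
  + by rewrite subr_gt0.
  + move=> r rs; apply: ramp_mid; rewrite -ler_norml.
    have := ler_normD (r - s) s; rewrite subrK; lra.
  + apply: is_derive_eq; rewrite /GRing.scale/=; ring.
- rewrite profile_out ?ltW//.
  apply: (@is_derive_local _ _ (cst ((0 < s)%R%:R)) _ _ (`|s| - 1)).
  + by rewrite subr_gt0.
  + move=> r rs; have rs' : 1 <= `|r|.
      have := ler_normD (s - r) r; rewrite subrK distrC; lra.
    rewrite ramp_out// (_ : (0 < r) = (0 < s))//; apply/idP/idP => h; move: rs s1 rs'.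
      rewrite (gtr0_norm h); case: (ltrP 0 s) => // s0; rewrite (ler0_norm s0).
      by rewrite ltr_norml; lra.
    rewrite (gtr0_norm h); case: (ltrP 0 r) => // r0; rewrite (ler0_norm r0).
    by rewrite ltr_norml; lra.
(* At [s = 1] and [s = -1] the cubic has double contact with the constant it joins, as in
   [1 - ramp r = (r - 1) ^+ 2 * (2 + r) / 4]; the quadratic criterion then gives derivative 0. *)
- rewrite profile_out ?s1//; apply: (@is_derive_quadratic _ _ _ _ 1) => r.
  have [r1|r1] := boolP (-1 <= r <= 1).
    have s2 : -1 <= s <= 1 by rewrite -ler_norml s1.
    rewrite !ramp_mid// mul0r subr0 mul1r.
    have /orP[/eqP ->|/eqP ->] : (s == 1) || (s == -1).
      by move/eqP: s1; rewrite eqr_norml => /andP[].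
      rewrite (_ : _ - _ = - (r - 1) ^+ 2 * ((2 + r) / 4)); last by ring.
      by rewrite normrM normrN (ger0_norm (sqr_ge0 _)) ler_piMr ?sqr_ge0// ler_norml; lra.
    rewrite (_ : _ - _ = (r + 1) ^+ 2 * ((2 - r) / 4)); last by ring.
    by rewrite opprK normrM (ger0_norm (sqr_ge0 _)) ler_piMr ?sqr_ge0// ler_norml; lra.
  have r2 : 1 <= `|r| by rewrite ler_normr; lra.
  rewrite !ramp_out ?s1// mul0r subr0 mul1r.
  have := s1; case: (ltrP 0 s) => s0; case: (ltrP 0 r) => r0.
  + by rewrite subrr normr0 sqr_ge0.
  + by rewrite (gtr0_norm s0) sub0r normrN normr1 => ->; move: r2; rewrite (ler0_norm r0); nra.
  + by rewrite (ler0_norm s0) subr0 normr1 => s2; move: r2; rewrite (gtr0_norm r0); nra.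
  + by rewrite subrr normr0 sqr_ge0.
Qed.

(* The value at [u <= 0] is the limit of [ramp (v / u)] as [u] tends to [0+]; the
   angle is cut along the half line [u <= 0, v = 0]. *)
Definition sector_angle u v : R := if 0 < u then ramp (v / u) else (0 < v)%R%:R.

(** The differential of [sector_angle] at [(u, v)] applied to the velocity [(p, q)]: the density at
    [v / u] times the rate of change of [v / u]. *)
Definition sector_form u v p q : R :=
  if 0 < u then profile (v / u) * (q / u - p * v / u ^+ 2) else 0.

Lemma ratio_ge1 u v : 0 < u -> u <= `|v| -> 1 <= `|v / u|.
Proof. by move=> u0 uv; rewrite normf_div (gtr0_norm u0) ler_pdivlMr// mul1r. Qed.

Lemma sector_angle_out u v : u <= `|v| -> sector_angle u v = (0 < v)%R%:R.
Proof.
move=> uv; rewrite /sector_angle; case: ifPn => // u0.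
by rewrite ramp_out ?ratio_ge1// pmulr_lgt0// invr_gt0.
Qed.

Lemma sector_form_out u v p q : u <= `|v| -> sector_form u v p q = 0.
Proof.
move=> uv; rewrite /sector_form; case: ifPn => // u0.
by rewrite profile_out ?mul0r ?ratio_ge1.
Qed.

Lemma sector_form_ge0 u v : 0 <= sector_form u v 0 1.
Proof.
rewrite /sector_form; case: ifP => // u0.
by rewrite mulr_ge0 ?profile_ge0// !mul0r subr0 divr_ge0// ltW.
Qed.

(** On the support [v / u] is at most 1 in absolute value. The right-hand side is a multiple of a
    nonnegative kernel independent of the velocity; it dominates the form in the Fubini
    arguments. *)
Lemma sector_form_le u v p q :
  `|sector_form u v p q| <= (`|p| + `|q|) * sector_form u v 0 1.
Proof.
rewrite /sector_form; case: ifPn => u0; last by rewrite normr0 mulr0.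
have [vu|uv] := ltP `|v| u; last by rewrite profile_out ?ratio_ge1// !mul0r normr0 mulr0.
rewrite normrM (ger0_norm (profile_ge0 _)) mulrCA ler_wpM2l ?profile_ge0//.
rewrite mul0r mul0r subr0 mul1r.
have vu1 : `|v / u| <= 1 by rewrite normf_div (gtr0_norm u0) ler_pdivrMr// mul1r ltW.
rewrite (_ : _ - _ = (q - p * (v / u)) / u); last by field; rewrite gt_eqF.
rewrite normf_div (gtr0_norm u0) ler_pM2r ?invr_gt0//.
apply: le_trans (ler_normB _ _) _; rewrite addrC normrM lerD2r.
by rewrite ler_piMr.
Qed.

Lemma continuous_nbhs_dist X t e : {for t, continuous X} -> 0 < e ->
  exists2 r, 0 < r & forall s, `|s - t| < r -> `|X s - X t| < e.
Proof.
move=> /cvgrPdist_lt cX e0; have /nbhs_ballP [r /= r0 H] := cX e e0.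
by exists r => // s st; rewrite distrC; apply: H; rewrite /ball/= distrC.
Qed.

(** With tolerance half of [Y t] in absolute value, the abscissa stays below that half and the
    ordinate stays beyond it, on the same side. *)
Lemma out_of_sector X Y t : {for t, continuous X} -> {for t, continuous Y} ->
  X t <= 0 -> Y t != 0 -> exists2 r, 0 < r & forall s, `|s - t| < r ->
    X s <= `|Y s| /\ (0 < Y s) = (0 < Y t).
Proof.
move=> cX cY X0 Y0; have e0 : 0 < `|Y t| / 2 by rewrite divr_gt0 ?normr_gt0.
have [r r0 Hr] := continuous_nbhs_dist cX e0.
have [q q0 Hq] := continuous_nbhs_dist cY e0.
exists (Num.min r q); first by rewrite lt_min r0.
move=> s; rewrite lt_min => /andP[/Hr Xs /Hq Ys].
have := Ys; rewrite ltr_norml; have := Xs; rewrite ltr_norml.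
move: Y0 e0 {Xs Ys}; rewrite neq_lt => /orP[Y0|Y0].
  rewrite (ltr0_norm Y0) => e0 /andP[? ?] /andP[? ?].
  by rewrite ltr0_norm; [split|]; [|apply/idP/idP|]; lra.
rewrite (gtr0_norm Y0) => e0 /andP[? ?] /andP[? ?].
by rewrite gtr0_norm; [split|]; [|apply/idP/idP|]; lra.
Qed.

Lemma sector_angle_derive X Y t p q : is_derive t 1 X p -> is_derive t 1 Y q ->
  (0 < X t) || (Y t != 0) ->
  is_derive t 1 (fun s => sector_angle (X s) (Y s)) (sector_form (X t) (Y t) p q).
Proof.
move=> dX dY; have cX := is_derive_continuous dX; have cY := is_derive_continuous dY.
have [X0 _|X0 /= Y0] := ltP 0 (X t).
  have [r r0 Hr] := continuous_nbhs_dist cX X0.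
  apply: (@is_derive_local _ _ (fun s => ramp (Y s / X s)) _ _ r) => //.
    by move=> s /Hr; rewrite ltr_norml /sector_angle => /andP[? ?]; rewrite ifT//; lra.
  have Xn : X t != 0 by rewrite gt_eqF.
  have dXV := is_deriveV Xn dX.
  have dYX : is_derive t 1 (fun s => Y s / X s) (q / X t - p * Y t / X t ^+ 2).
    have h := is_deriveM dY dXV; apply: (is_derive_eq h).
    by rewrite /GRing.scale/=; field.
  by rewrite /sector_form X0; exact: is_derive1_comp (ramp_derive _) dYX.
have [r r0 Hr] := out_of_sector cX cY X0 Y0.
rewrite sector_form_out; last by apply: le_trans X0 _.
apply: (@is_derive_local _ _ (cst ((0 < Y t)%R%:R)) _ _ r) => //.
by move=> s /Hr[? YE]; rewrite sector_angle_out// YE.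
Qed.

(** Unlike the angle, the form has no cut: it vanishes near every point with [X t <= 0] other than
    the origin. The origin is the only exception, that is, the base point lying on the curve. *)
Lemma sector_form_continuous X Y P Q t : {for t, continuous X} ->
  {for t, continuous Y} -> {for t, continuous P} -> {for t, continuous Q} ->
  (X t != 0) || (Y t != 0) ->
  {for t, continuous (fun s => sector_form (X s) (Y s) (P s) (Q s))}.
Proof.
move=> cX cY cP cQ XY.
have near_cst (f g : R -> R) r : 0 < r -> (forall s, `|s - t| < r -> f s = g s) ->
    {for t, continuous g} -> {for t, continuous f}.
  move=> r0 fg; rewrite /prop_for /continuous_at (fg t) ?subrr ?normr0//.
  apply: cvg_trans; apply: near_eq_cvg; near=> s; apply/esym/fg; rewrite distrC.
  by near: s; exact: (@nbhsx_ballx _ _ t r r0).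
have [X0|X0] := ltP 0 (X t).
  have [r r0 Hr] := continuous_nbhs_dist cX X0.
  apply: (near_cst _ (fun s => profile (Y s / X s) *
      (Q s / X s - P s * Y s / X s ^+ 2)) r) => //.
    by move=> s /Hr; rewrite ltr_norml /sector_form => /andP[? ?]; rewrite ifT//; lra.
  have Xn : X t != 0 by rewrite gt_eqF.
  have cXV : {for t, continuous (fun s => (X s)^-1)} by exact: cvgV.
  apply: cvgM.
    have : {for t, continuous (fun s => Y s / X s)} by exact: cvgM.
    by move=> h; apply: (continuous_comp h); exact: profile_continuous.
  apply: cvgB; first exact: cvgM.
  apply: cvgM; first exact: cvgM.
  by apply: cvgV; [exact: expf_neq0|exact: cvgM].
have : exists2 r, 0 < r & forall s, `|s - t| < r -> X s <= `|Y s|.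
  have [Y0|Y0] := eqVneq (Y t) 0.
    rewrite Y0 eqxx orbF in XY.
    have Xt0 : 0 < - X t by rewrite oppr_gt0 lt_neqAle XY.
    have [r r0 Hr] := continuous_nbhs_dist cX Xt0; exists r => // s /Hr.
    rewrite ltr_norml => /andP[? ?]; apply: le_trans (normr_ge0 _); lra.
  have [r r0 Hr] := out_of_sector cX cY X0 Y0; exists r => // s.
  by move=> /Hr[].
move=> [r r0 Hr]; apply: (near_cst _ (cst 0) r) => //; last exact: cvg_cst.
by move=> s /Hr; exact: sector_form_out.
Unshelve. all: by end_near. Qed.

End kernel.

(** * Winding numbers of subdivided curves *)

Section curves.
Context {R : realType}.

(** The derivatives are separate fields so that they can be continuous on the whole line while being
    derivatives on the closed piece only. *)
Record plane_arc := PlaneArc { arcx : R -> R; arcy : R -> R; arcdx : R -> R; arcdy : R -> R }.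

Definition arc_on (c d : R) (x y : R -> R) (g : plane_arc) : Prop :=
  [/\ [/\ continuous (arcx g), continuous (arcy g), continuous (arcdx g) &
        continuous (arcdy g)],
      forall t, c <= t <= d -> is_derive t 1 (arcx g) (arcdx g t),
      forall t, c <= t <= d -> is_derive t 1 (arcy g) (arcdy g t),
      forall t, c <= t <= d -> arcx g t = x t &
      forall t, c <= t <= d -> arcy g t = y t].

Definition subdivided_curve (n : nat) (s : nat -> R) (x y : R -> R)
    (g : nat -> plane_arc) : Prop :=
  forall i, (i < n)%N -> s i < s i.+1 /\ arc_on (s i) (s i.+1) x y (g i).

Lemma subdivided_curve_exists (a b : R) (x y : R -> R) :
  piecewise_C1 a b x -> piecewise_C1 a b y ->
  exists n s g, [/\ s 0%N = a, s n = b & subdivided_curve n s x y g].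
Proof.
move=> cx cy; have [n [s [s0 sn si Hs]]] := piecewise_C1_meet cx cy.
have H i : exists g : plane_arc, (i < n)%N -> arc_on (s i) (s i.+1) x y g.
  have [ni|ni] := ltnP i n; last by exists (PlaneArc id id id id).
  have [C1x C1y] := Hs i ni.
  have [X [P [? ? ? ?]]] := C1_extension (si i ni) C1x.
  have [Y [Q [? ? ? ?]]] := C1_extension (si i ni) C1y.
  by exists (PlaneArc X Y P Q).
have [g Hg] := boolp.choice H.
by exists n, s, g; split => // i ni; split; [exact: si|exact: Hg].
Qed.

Definition arc_form (g : plane_arc) (p : R * R) (t : R) : R :=
  sector_form (arcx g t - p.1) (arcy g t - p.2) (arcdx g t) (arcdy g t).

(** A full turn counts 1, since [ramp] rises from 0 to 1 through the sector. The number is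
    meaningful for [p] off the curve, where the integrands are continuous. *)
Definition winding n (s : nat -> R) (g : nat -> plane_arc) (p : R * R) : R :=
  \sum_(i < n) \int[lebesgue_measure]_(t in `[s i, s i.+1]) arc_form (g i) p t.

Section winding.
Variables (n : nat) (s : nat -> R) (x y : R -> R) (g : nat -> plane_arc).
Hypothesis sg : subdivided_curve n s x y g.

Lemma subdivision_mono i k : (i <= k <= n)%N -> s i <= s k.
Proof.
move=> /andP[]; elim: k => [|k IH]; first by rewrite leqn0 => /eqP ->.
rewrite leq_eqVlt => /predU1P[->//|]; rewrite ltnS => ik kn.
by apply: le_trans (IH ik (ltnW kn)) _; apply: ltW; have [] := sg kn.
Qed.

Lemma subdivision_itv i t : (i < n)%N -> s i <= t <= s i.+1 -> s 0%N <= t <= s n.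
Proof.
move=> ni /andP[h1 h2]; rewrite (le_trans _ h1)/= ?(le_trans h2)//.
  by apply: subdivision_mono; rewrite ni leqnn.
by apply: subdivision_mono; rewrite /= ltnW.
Qed.

Lemma subdivision_disjoint i k t : (i < n)%N -> (k < n)%N ->
  s i <= t <= s i.+1 -> s k < t < s k.+1 -> i = k.
Proof.
move=> ni nk /andP[it ti] /andP[kt tk]; apply/eqP; rewrite eqn_leq.
apply/andP; split; rewrite leqNgt; apply/negP => ik.
  have := @subdivision_mono k.+1 i; rewrite ik ltnW// => /(_ isT).
  by move=> h; have := lt_le_trans tk h; rewrite ltNge it.
have := @subdivision_mono i.+1 k; rewrite ik ltnW// => /(_ isT).
by move=> h; have := lt_le_trans (le_lt_trans h kt) ti; rewrite ltxx.
Qed.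

Definition off_curve (p : R * R) := forall t, s 0%N <= t <= s n -> (x t, y t) <> p.

Lemma arc_form_within i p : (i < n)%N -> off_curve p ->
  {within `[s i, s i.+1], continuous (arc_form (g i) p)}.
Proof.
move=> ni op; apply: continuous_in_subspaceT => t; rewrite inE/= in_itv/= => ti.
have [_ [[cX cY cP cQ] _ _ xE yE]] := sg ni.
apply: (@sector_form_continuous _ (fun t => arcx (g i) t - p.1)
  (fun t => arcy (g i) t - p.2) (arcdx (g i)) (arcdy (g i))); try exact: cvgB (cX t) (cvg_cst _);
  try exact: cvgB (cY t) (cvg_cst _).
- exact: cP.
- exact: cQ.
rewrite !subr_eq0 xE// yE// -negb_and; apply/negP => /andP[/eqP xp /eqP yp].
by apply: (op t (subdivision_itv ni ti)); rewrite xp yp -surjective_pairing.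
Qed.

(** [E] is a potential for the difference of the two forms, so the integrals over the pieces
    telescope. It may depend on time as well as on position, which leaves room to compensate a jump
    of the angles. *)
Lemma winding_diff p q (E : R -> R -> R -> R) : off_curve p -> off_curve q ->
  (forall i t, (i < n)%N -> s i <= t <= s i.+1 ->
    is_derive t 1 (fun r => E r (arcx (g i) r) (arcy (g i) r))
      (arc_form (g i) p t - arc_form (g i) q t)) ->
  winding n s g p - winding n s g q =
  E (s n) (x (s n)) (y (s n)) - E (s 0%N) (x (s 0%N)) (y (s 0%N)).
Proof.
move=> op oq dE; rewrite /winding -sumrB.
pose F t := E t (x t) (y t).
rewrite (eq_bigr (fun i : 'I_n => F (s i.+1) - F (s i))).
  by rewrite -(big_mkord xpredT (fun i => F (s i.+1) - F (s i))) telescope_sumr.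
move=> [i /= ni] _; have [/ltW si [_ _ _ xE yE]] := sg ni.
have int r : off_curve r ->
    lebesgue_measure.-integrable `[s i, s i.+1] (EFin \o arc_form (g i) r).
  move=> or_; apply: continuous_compact_integrable; first exact: segment_compact.
  exact: arc_form_within.
rewrite -RintegralB//; [|exact: int|exact: int].
have e1 : s i <= s i <= s i.+1 by rewrite lexx.
have e2 : s i <= s i.+1 <= s i.+1 by rewrite lexx si.
rewrite (Rintegral_derive si _ (fun t => dE i t ni)).
  by rewrite /F !xE// !yE.
move=> t; apply: cvgB; exact: arc_form_within.
Qed.

(** The sector opens to the right of [p], so the curve never enters it. *)
Lemma winding_right p : (forall t, s 0%N <= t <= s n -> x t <= p.1) ->
  winding n s g p = 0.
Proof.
move=> xp; rewrite /winding big1// => -[i /= ni] _.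
have [_ [_ _ _ xE yE]] := sg ni.
rewrite (@eq_Rintegral _ _ _ _ _ (cst 0)); first by rewrite Rintegral_cst// mul0r.
move=> t; rewrite inE/= in_itv/= => ti.
apply: sector_form_out; apply: le_trans (normr_ge0 _).
by rewrite subr_le0 xE// xp//; exact: subdivision_itv ti.
Qed.

Lemma arc_angle_derive i p t : (i < n)%N -> s i <= t <= s i.+1 ->
  (p.1 < x t) || (y t != p.2) ->
  is_derive t 1 (fun r => sector_angle (arcx (g i) r - p.1) (arcy (g i) r - p.2))
    (arc_form (g i) p t).
Proof.
move=> ni ti; have [_ [_ dX dY xE yE]] := sg ni => xy.
have dX' : is_derive t 1 (fun r => arcx (g i) r - p.1) (arcdx (g i) t).
  have h := is_deriveB (dX t ti) (is_derive_cst p.1 t 1).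
  by apply: (is_derive_eq h); rewrite subr0.
have dY' : is_derive t 1 (fun r => arcy (g i) r - p.2) (arcdy (g i) t).
  have h := is_deriveB (dY t ti) (is_derive_cst p.2 t 1).
  by apply: (is_derive_eq h); rewrite subr0.
have := sector_angle_derive dX' dY'; apply.
by rewrite subr_gt0 subr_eq0 xE// yE.
Qed.

Lemma arc_form_left i p t : (i < n)%N -> s i <= t <= s i.+1 -> x t <= p.1 ->
  arc_form (g i) p t = 0.
Proof.
move=> ni ti xp; have [_ [_ _ _ xE yE]] := sg ni.
by apply: sector_form_out; apply: le_trans (normr_ge0 _); rewrite subr_le0 xE.
Qed.

Lemma arc_near i t e : (i < n)%N -> s i <= t <= s i.+1 -> 0 < e ->
  exists2 r, 0 < r & forall u, `|u - t| < r ->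
    `|arcx (g i) u - x t| < e /\ `|arcy (g i) u - y t| < e.
Proof.
move=> ni ti e0; have [_ [[cX cY _ _] _ _ xE yE]] := sg ni.
have [r r0 Hr] := continuous_nbhs_dist (cX t) e0.
have [q q0 Hq] := continuous_nbhs_dist (cY t) e0.
exists (Num.min r q); first by rewrite lt_min r0.
by move=> u; rewrite lt_min => /andP[/Hr + /Hq]; rewrite (xE t ti) (yE t ti).
Qed.

Hypothesis closed_curve : (x (s n), y (s n)) = (x (s 0%N), y (s 0%N)).

(* The difference of the two angle functions vanishes where the curve passes
   from [x > p.1 - r / 2] to [x <= p.1 - r / 2], because it avoids the square
   around [p]; replacing it by [0] further left removes the cuts of both angles. *)
Lemma winding_locally_constant p q r : 0 < r ->
  (forall t, s 0%N <= t <= s n -> `|x t - p.1| < r -> r <= `|y t - p.2|) ->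
  `|q.1 - p.1| < r / 4 -> `|q.2 - p.2| < r / 4 ->
  winding n s g p = winding n s g q.
Proof.
case: p q => [a b] [a' b'] /= r0 far; rewrite !ltr_norml => /andP[a1 a2] /andP[b1 b2].
have op : off_curve (a, b).
  by move=> t ti [xa yb]; have := far t ti; rewrite xa yb !subrr normr0 r0; lra.
have oq : off_curve (a', b').
  move=> t ti [xa yb]; have := far t ti; rewrite xa yb.
  have h1 : `|a' - a| < r by rewrite ltr_norml; lra.
  have : `|b' - b| < r by rewrite ltr_norml; lra.
  by move=> h2 /(_ h1); rewrite leNgt h2.
apply/eqP; rewrite -subr_eq0.
pose E (t u v : R) := if a - r / 2 < u then
  sector_angle (u - a) (v - b) - sector_angle (u - a') (v - b') else 0.
suff dE i t : (i < n)%N -> s i <= t <= s i.+1 ->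
    is_derive t 1 (fun u => E u (arcx (g i) u) (arcy (g i) u))
      (arc_form (g i) (a, b) t - arc_form (g i) (a', b') t).
  by rewrite (winding_diff op oq dE); case: closed_curve => -> ->; rewrite subrr.
move=> ni ti; have tn := subdivision_itv ni ti.
have [ar|ar] := ltP (a - r / 2) (x t).
  have e0 : 0 < x t - (a - r / 2) by rewrite subr_gt0.
  have [d d0 Hd] := arc_near ni ti e0.
  apply: (@is_derive_local _ _ (fun u =>
      sector_angle (arcx (g i) u - a) (arcy (g i) u - b) -
      sector_angle (arcx (g i) u - a') (arcy (g i) u - b')) _ _ d) => //.
    by move=> u /Hd[]; rewrite ltr_norml /E => /andP[? ?] _; rewrite ifT//; lra.
  have far' : x t <= a + r / 4 -> r <= `|y t - b|.
    by move=> h; apply: far => //; rewrite ltr_norml; lra.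
  have d1 := @arc_angle_derive i (a, b) t ni ti.
  have d2 := @arc_angle_derive i (a', b') t ni ti.
  apply: is_deriveB; [apply: d1|apply: d2] => /=; have [//|/= h] := ltP.
    have := far' _; rewrite -subr_eq0 -normr_gt0; lra.
  have := far' _; rewrite ler_normr => H.
  by apply/negP => /eqP yb; move: H; rewrite yb; lra.
rewrite !arc_form_left ?subrr//=; [|lra|lra].
have [ar'|ar'] := ltP (a - r) (x t); last first.
  have e0 : 0 < r / 2 by lra.
  have [d d0 Hd] := arc_near ni ti e0.
  apply: (@is_derive_local _ _ (cst 0) _ _ d) => //.
  by move=> u /Hd[]; rewrite ltr_norml /E => /andP[? ?] _; rewrite ifF//; apply/negbTE; rewrite -leNgt; lra.
(* In the remaining strip the curve is above or below the square, hence on the same side of [b] and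
   [b']. Both abscissas relative to the base points stay nonpositive thanks to the margins [r / 4],
   so the two angles agree and [E] is 0 on either side of its threshold. *)
have yb : r <= `|y t - b| by apply: far => //; rewrite ltr_norml; lra.
have e0 : 0 < r / 4 by lra.
have [d d0 Hd] := arc_near ni ti e0.
apply: (@is_derive_local _ _ (cst 0) _ _ d) => //.
move=> u /Hd[]; rewrite !ltr_norml /E => /andP[? ?] /andP[? ?]; case: ifP => // _.
rewrite !sector_angle_out; try by apply: le_trans (normr_ge0 _); lra.
rewrite (_ : (0 < arcy (g i) u - b) = (0 < arcy (g i) u - b')) ?subrr//.
by move: yb; rewrite ler_normr => /orP[?|?]; apply/idP/idP; lra.
Qed.

End winding.
End curves.

Section winding_jump.
Context {R : realType}.
Variables (n : nat) (s : nat -> R) (x y : R -> R) (g : nat -> @plane_arc R).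
Hypothesis sg : subdivided_curve n s x y g.
Hypothesis closed_curve : (x (s n), y (s n)) = (x (s 0%N), y (s 0%N)).

(* Along the curve the difference of the angles seen from both points jumps only
   where the curve crosses the segment between them; [J] compensates that jump. *)
Lemma winding_jump a a' b j t0 : (j < n)%N -> s j < t0 < s j.+1 ->
  y t0 = b -> a < x t0 < a' -> arcdy (g j) t0 != 0 ->
  (forall t, s 0%N <= t <= s n -> y t = b -> a <= x t <= a' -> t = t0) ->
  winding n s g (a, b) - winding n s g (a', b) = Num.sg (arcdy (g j) t0).
Proof.
move=> nj t0j yb /andP[ax xa'] dy0 only.
have t0j' : s j <= t0 <= s j.+1 by case/andP: t0j => *; rewrite !ltW.
have t0n := subdivision_itv sg nj t0j'.
have off c : a <= c <= a' -> c != x t0 -> off_curve n s x y (c, b).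
  move=> ca cx t tn [xc yc]; move: cx; rewrite -xc (only t tn yc) ?eqxx//.
  by rewrite xc.
have op : off_curve n s x y (a, b) by apply: off; rewrite ?lexx ?lt_eqF//; lra.
have oq : off_curve n s x y (a', b) by apply: off; rewrite ?lexx ?gt_eqF//; lra.
pose J (t : R) : R := if 0 < arcdy (g j) t0 then (t0 < t)%R%:R else - (t0 <= t)%R%:R.
pose E (t u v : R) := sector_angle (u - a) (v - b) - sector_angle (u - a') (v - b) + J t.
have J_cst t u : t != t0 -> `|u - t| < `|t - t0| -> J u = J t.
  move=> tt0 ut; suff [e1 e2] : (t0 < u) = (t0 < t) /\ (t0 <= u) = (t0 <= t).
    by rewrite /J e1 e2.
  move: ut {dy0 only off op oq E J}; rewrite ltr_norml.
  have [h|h] := ltP t t0.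
    by rewrite ltr0_norm ?subr_lt0// => /andP[? ?]; split; apply/idP/idP; lra.
  have h' : t0 < t by rewrite lt_neqAle eq_sym tt0.
  by rewrite gtr0_norm ?subr_gt0// => /andP[? ?]; split; apply/idP/idP; lra.
suff dE i t : (i < n)%N -> s i <= t <= s i.+1 ->
    is_derive t 1 (fun u => E u (arcx (g i) u) (arcy (g i) u))
      (arc_form (g i) (a, b) t - arc_form (g i) (a', b) t).
  rewrite (winding_diff sg op oq dE) /E; case: closed_curve => -> ->.
  have t1 : s 0%N < t0.
    by case/andP: t0j => h _; apply: le_lt_trans h; apply: (subdivision_mono sg); rewrite /= ltnW.
  have t2 : t0 < s n.
    by case/andP: t0j => _ h; apply: lt_le_trans h _; apply: (subdivision_mono sg); rewrite nj leqnn.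
  transitivity (J (s n) - J (s 0%N)); first by ring.
  rewrite /J; move: dy0; rewrite neq_lt => /orP[h|h].
    rewrite ltr0_sg// (_ : (0 < arcdy (g j) t0) = false); last by apply/negbTE; rewrite -leNgt ltW.
    by rewrite (ltW t2) leNgt t1 /= oppr0 subr0.
  by rewrite gtr0_sg// h t2 ltNge (ltW t1) subr0.
move=> ni ti; have tn := subdivision_itv sg ni ti.
have d1 := arc_angle_derive sg (p := (a, b)) ni ti.
have d2 := arc_angle_derive sg (p := (a', b)) ni ti.
have [tE|tt0] := eqVneq t t0; last first.
  have r0 : 0 < `|t - t0| by rewrite normr_gt0 subr_eq0.
  have dJ : is_derive t 1 J 0.
    by apply: (@is_derive_local _ _ (cst (J t)) _ _ _ r0) => // u; exact: J_cst.
  have [yt|yt] := eqVneq (y t) b; last first.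
    have h := is_deriveD (is_deriveB (d1 _) (d2 _)) dJ.
    by rewrite -[X in is_derive _ _ _ X]addr0; apply: h; rewrite /= yt orbT.
  have [xt|xt] := ltP a' (x t).
    have h := is_deriveD (is_deriveB (d1 _) (d2 _)) dJ.
    by rewrite -[X in is_derive _ _ _ X]addr0; apply: h; rewrite /= ?xt//; apply/orP; left; lra.
  have xa : x t < a.
    rewrite ltNge; apply/negP => ax'; move/eqP: tt0; apply; apply: only => //.
    by rewrite ax'.
  rewrite !(arc_form_left sg) //=; try exact: ltW.
  have e0 : 0 < a - x t by rewrite subr_gt0.
  have [d d0 Hd] := arc_near sg ni ti e0.
  apply: (@is_derive_local _ _ J _ _ (Num.min d `|t - t0|)); last 2 first.
  + move=> u; rewrite lt_min => /andP[/Hd[+ _] ut].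
    rewrite ltr_norml /E => /andP[? ?].
    by rewrite !sector_angle_out ?subrr ?add0r//; apply: le_trans (normr_ge0 _); lra.
  + by rewrite subr0.
  + by rewrite lt_min d0.
subst t; have ij : i = j by exact: (subdivision_disjoint sg ni nj ti t0j).
subst i; rewrite (arc_form_left sg (p := (a', b)) ni ti) /= ?subr0; last exact: ltW.
have [_ [_ _ dY xE yE]] := sg nj.
(* Half the slope as tolerance keeps the sign of [arcy (g j) u - b] equal to that of
   [arcdy (g j) t0 * (u - t0)]. *)
have q0 : 0 < `|arcdy (g j) t0| / 2 by rewrite divr_gt0// normr_gt0.
have [q qp Hq] := is_derive_approx (dY t0 ti) q0.
have e0 : 0 < Num.min (x t0 - a) (a' - x t0) by rewrite lt_min !subr_gt0 ax.
have [d dp Hd] := arc_near sg ni ti e0.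
(* Near [t0] the angle seen from the right point is 1 above the line and 0 on or below it.
   Subtracted from [J], it leaves the constant [c]; the strict and the large inequality in [J] are
   chosen so that this holds at [u = t0] as well. *)
pose c : R := if 0 < arcdy (g j) t0 then 0 else -1.
apply: (@is_derive_local _ _ (fun u =>
    sector_angle (arcx (g j) u - a) (arcy (g j) u - b) + c) _ _ (Num.min d q)).
- by rewrite lt_min dp.
- move=> u; rewrite lt_min => /andP[/Hd[xu _] /Hq]; rewrite (yE t0 ti) yb => Yu.
  rewrite /E -addrA; congr (_ + _).
  rewrite sector_angle_out; last first.
    apply: le_trans (normr_ge0 _); move: xu; rewrite lt_min => /andP[_].
    by rewrite ltr_norml; lra.
  move: dy0 Yu; rewrite /J /c neq_lt subr_gt0 ler_norml => /orP[] Q0.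
    rewrite (ltr0_norm Q0) (_ : (0 < arcdy (g j) t0) = false); last first.
      by apply/negbTE; rewrite -leNgt ltW.
    have [ut|ut] := ltP u t0.
      rewrite ltr0_norm ?subr_lt0// => /andP[h1 h2].
      by rewrite (_ : b < _); [rewrite oppr0 addr0|nra].
    rewrite ger0_norm ?subr_ge0// => /andP[h1 h2].
    by rewrite ltNge (_ : _ <= b); [rewrite oppr0 add0r|nra].
  rewrite (gtr0_norm Q0) Q0; have [ut|ut] := ltP t0 u.
    rewrite gtr0_norm ?subr_gt0// => /andP[h1 h2].
    by rewrite (_ : b < _); [rewrite addNr|nra].
  rewrite ler0_norm ?subr_le0// => /andP[h1 h2].
  by rewrite ltNge (_ : _ <= b); [rewrite oppr0 addr0|nra].
- have h := is_deriveD (d1 _) (is_derive_cst c t0 1).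
  by rewrite -[X in is_derive _ _ _ X]addr0; apply: h; rewrite /= ax.
Qed.

End winding_jump.

(** * Integrating the winding number *)

Section rectangles.
Local Open Scope ereal_scope.
Context d1 d2 (T1 : measurableType d1) (T2 : measurableType d2) (R : realType).
Variable m1 : {sigma_finite_measure set T1 -> \bar R}.
Variable m2 : {sigma_finite_measure set T2 -> \bar R}.
Variables (A : set T1) (B : set T2) (f : T1 * T2 -> \bar R).
Hypotheses (mA : measurable A) (mB : measurable B).

(** Extension by zero carries the theorems on the whole product over to rectangles: slices outside
    [A] have zero inner integral. *)
Lemma fubini_F_patch : fubini_F m2 (f \_ (A `*` B)) =
  (fun x => \int[m2]_(y in B) f (x, y)) \_ A.
Proof.
apply/funext => x; rewrite /fubini_F patchE; case: ifPn => xA.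
  rewrite [RHS]integral_mkcond; apply: eq_integral => y _.
  by rewrite !patchE in_setX /= xA.
by apply: integral0_eq => y _; rewrite patchE in_setX /= (negbTE xA).
Qed.

Lemma fubini_G_patch : fubini_G m1 (f \_ (A `*` B)) =
  (fun y => \int[m1]_(x in A) f (x, y)) \_ B.
Proof.
apply/funext => y; rewrite /fubini_G patchE; case: ifPn => yB.
  rewrite [RHS]integral_mkcond; apply: eq_integral => x _.
  by rewrite !patchE in_setX /= yB andbT.
by apply: integral0_eq => x _; rewrite patchE in_setX /= (negbTE yB) andbF.
Qed.

Lemma tonelli_rectangle : measurable_fun setT f -> (forall z, 0 <= f z) ->
  \int[m1 \x m2]_(z in A `*` B) f z = \int[m1]_(x in A) \int[m2]_(y in B) f (x, y).
Proof.
move=> mf f0; rewrite integral_mkcond fubini_tonelli1.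
- by rewrite fubini_F_patch -integral_mkcond.
- by apply/(measurable_restrictT _ (measurableX mA mB)); exact: measurable_funTS.
- by move=> z; rewrite patchE; case: ifP.
Qed.

Lemma tonelli_rectangle2 : measurable_fun setT f -> (forall z, 0 <= f z) ->
  \int[m1 \x m2]_(z in A `*` B) f z = \int[m2]_(y in B) \int[m1]_(x in A) f (x, y).
Proof.
move=> mf f0; rewrite integral_mkcond fubini_tonelli2.
- by rewrite fubini_G_patch -integral_mkcond.
- by apply/(measurable_restrictT _ (measurableX mA mB)); exact: measurable_funTS.
- by move=> z; rewrite patchE; case: ifP.
Qed.

Lemma fubini_rectangle : (m1 \x m2).-integrable (A `*` B) f ->
  [/\ m1.-integrable A (fun x => \int[m2]_(y in B) f (x, y)),
    \int[m1 \x m2]_(z in A `*` B) f z = \int[m1]_(x in A) \int[m2]_(y in B) f (x, y) &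
    \int[m1]_(x in A) \int[m2]_(y in B) f (x, y) =
    \int[m2]_(y in B) \int[m1]_(x in A) f (x, y)].
Proof.
move=> /(integrable_mkcond _ (measurableX mA mB)) intf; split.
- by apply/(integrable_mkcond _ mA); rewrite -fubini_F_patch; exact: integrable_fubini_F.
- by rewrite integral_mkcond -integral12_prod_meas1// fubini_F_patch -integral_mkcond.
rewrite [LHS]integral_mkcond [RHS]integral_mkcond.
by rewrite -fubini_F_patch -fubini_G_patch integral12_prod_meas1// integral21_prod_meas1.
Qed.

End rectangles.

(** * The sector form as a kernel in the base point *)

Section sector_measurable.
Context {R : realType}.

Local Notation plane := (measurableTypeR R * measurableTypeR R)%type.

Lemma measurable_invr : measurable_fun setT (@GRing.inv R).
Proof.
rewrite -(setUv [set 0]); apply/measurable_funU => //; first exact: measurableC.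
split; first exact: measurable_fun_set1.
apply: open_continuous_measurable_fun; last first.
  by move=> r; rewrite inE/= => /eqP r0; apply: cvgV => //; exact: cvg_id.
rewrite openC; apply: accessible_closed_set1.
by apply: hausdorff_accessible; exact: Rhausdorff.
Qed.

Lemma measurable_sector_form d (T : measurableType d) (u v p q : T -> R) :
  measurable_fun setT u -> measurable_fun setT v ->
  measurable_fun setT p -> measurable_fun setT q ->
  measurable_fun setT (fun z => sector_form (u z) (v z) (p z) (q z)).
Proof.
move=> mu mv mp mq.
have muV : measurable_fun setT (fun z => (u z)^-1) by exact: measurableT_comp measurable_invr mu.
apply: measurable_fun_ifT => //; first exact: measurable_fun_ltr.
apply: measurable_funM.
  apply: measurableT_comp; last exact: measurable_funM.
  exact: continuous_measurable_fun profile_continuous.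
apply: measurable_funB; first exact: measurable_funM.
apply: measurable_funM; first exact: measurable_funM.
by apply: measurableT_comp measurable_invr _; exact: measurable_funX.
Qed.

(** The positive part has a corner at 0, but its square does not; through this the square of
    [profile] is differentiable everywhere. *)
Lemma sqr_max0_derive (s : R) :
  is_derive s 1 (fun r => Num.max 0 r ^+ 2) (2 * Num.max 0 s).
Proof.
apply: (@is_derive_quadratic _ _ _ _ 1) => r.
have rs := sqr_ge0 (r - s); have r2 := sqr_ge0 r; have s2 := sqr_ge0 s.
case: (ltP 0 r) => r0; case: (ltP 0 s) => s0; rewrite ler_norml mul1r.
- by apply/andP; split; lra.
- have : 0 <= - s * r by apply: mulr_ge0; lra.
  by move=> ?; apply/andP; split; lra.
- have : 0 <= s * - r by apply: mulr_ge0; lra.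
  by move=> ?; apply/andP; split; lra.
- by apply/andP; split; lra.
Qed.

(** Provides a primitive of [s * profile s], the factor that multiplies [dx] in the form. *)
Lemma profile_sqr_derive (s : R) :
  is_derive s 1 (fun r => profile r ^+ 2) (- 3 * s * profile s).
Proof.
have d1 : is_derive s 1 (fun r : R => 1 - r ^+ 2) (- (2 * s)).
  by apply: is_derive_eq; rewrite /GRing.scale/=; ring.
have d2 := @is_derive1_comp R (fun r => Num.max 0 r ^+ 2) (fun r => 1 - r ^+ 2) s _ _
  (sqr_max0_derive (1 - s ^+ 2)) d1.
have d3 := is_deriveZ (9 / 16) d2.
have e : (9 / 16) *: (2 * Num.max 0 (1 - s ^+ 2) * - (2 * s)) = - 3 * s * profile s.
  by rewrite /profile /GRing.scale/=; field.
apply: is_derive_local ltr01 _ (is_derive_eq d3 e) => r _.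
by transitivity (9 / 16 * Num.max 0 (1 - r ^+ 2) ^+ 2) => //; rewrite /profile; field.
Qed.

Lemma sector_form_continuous_y (u y p q : R) : 0 < u ->
  continuous (fun b => sector_form u (y - b) p q).
Proof.
move=> u0 b.
have := @sector_form_continuous R (cst u) (fun b => y - b) (cst p) (cst q) b; apply.
- exact: cvg_cst.
- by apply: cvgB; [exact: cvg_cst|exact: cvg_id].
- exact: cvg_cst.
- exact: cvg_cst.
- by rewrite /= gt_eqF.
Qed.

(** The condition on [L] puts the support [[y - u, y + u]] inside the interval. The part in [q] is
    then [q] times a density of mass one, and the part in [p] is odd about [y] and cancels. *)
Lemma integral_sector_form_y (u y p q L : R) : 0 < u -> `|y| + u <= L ->
  (\int[lebesgue_measure]_(b in `[(- L)%R, L]) (sector_form u (y - b) p q)%:E = q%:E)%E.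
Proof.
move=> u0 yuL.
have L0 : - L <= L by have := normr_ge0 y; lra.
pose F b := - (q * ramp ((y - b) / u)) - p / 3 * profile ((y - b) / u) ^+ 2.
have dF (b : R) : is_derive b 1 F (sector_form u (y - b) p q).
  have d1 : is_derive b 1 (fun b : R => (y - b) / u) (- u^-1).
    by apply: is_derive_eq; rewrite /GRing.scale/=; ring.
  have d2 := @is_derive1_comp R ramp (fun b : R => (y - b) / u) b _ _ (ramp_derive _) d1.
  have d3 := @is_derive1_comp R (fun r : R => profile r ^+ 2) (fun b : R => (y - b) / u) b _ _
    (profile_sqr_derive _) d1.
  have d4 := is_deriveB (is_deriveN (is_deriveZ q d2)) (is_deriveZ (p / 3) d3).
  apply: (is_derive_eq d4); rewrite /sector_form u0 /GRing.scale/=; field.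
  by rewrite gt_eqF.
have FL : F L - F (- L) = q.
  have yL : y - L <= - u by have := ler_norm y; lra.
  have yL' : u <= y + L by have := ler_norm (- y); rewrite normrN; lra.
  rewrite /F !(profile_out, ramp_out); last first.
  - by apply: ratio_ge1 => //; rewrite ler_normr; lra.
  - by apply: ratio_ge1 => //; rewrite ler_normr; lra.
  - by apply: ratio_ge1 => //; rewrite ler_normr; lra.
  - by apply: ratio_ge1 => //; rewrite ler_normr; lra.
  rewrite !pmulr_lgt0 ?invr_gt0// (_ : (0 < y - L) = false); last by apply/negbTE; rewrite -leNgt; lra.
  by rewrite (_ : 0 < y - - L) ?opprK//=; [ring|lra].
have cF : {within `[- L, L], continuous (fun b => sector_form u (y - b) p q)}.
  by apply: continuous_subspaceT; exact: sector_form_continuous_y.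
transitivity ((F L - F (- L))%:E); last by rewrite FL.
rewrite -(Rintegral_derive L0 cF (fun b _ => dF b)) /Rintegral fineK//.
apply: integrable_fin_num => //.
by apply: continuous_compact_integrable => //; exact: segment_compact.
Qed.

(** Exactly the abscissas [a < x] contribute, each with weight [q], and they fill a length [x + M].
    Since [x - a <= 2 * M], the condition on [L] leaves room for every sector. *)
Lemma integral_sector_form_box (x y p q M L : R) : `|x| <= M -> `|y| + 2 * M <= L ->
  let box : set (R * R) := `[- M, M] `*` `[- L, L] in
  let mu2 := (@lebesgue_measure R \x @lebesgue_measure R)%E in
  mu2.-integrable box (fun z => (sector_form (x - z.1) (y - z.2) p q)%:E) /\
  (\int[mu2]_(z in box) (sector_form (x - z.1) (y - z.2) p q)%:E = (q * (x + M))%:E)%E.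
Proof.
move=> xM yL box mu2.
have mM : measurable (`[- M, M] : set (measurableTypeR R)) by exact: measurable_itv.
have mL : measurable (`[- L, L] : set (measurableTypeR R)) by exact: measurable_itv.
have mbox : measurable (box : set plane) by exact: measurableX.
have mform p' q' : measurable_fun setT
    (fun z : plane => (sector_form (x - z.1) (y - z.2) p' q')%:E).
  apply/measurable_EFinP; apply: measurable_sector_form => //.
  - by apply: measurable_funB => //; exact: measurable_fst.
  - by apply: measurable_funB => //; exact: measurable_snd.
have slice p' q' a : a \in `[- M, M] ->
    (\int[lebesgue_measure]_(b in `[(- L)%R, L])
      (sector_form (x - a) (y - b) p' q')%:E = (q' * \1_(`]-oo, x[) a)%:E)%E.
  rewrite in_itv/= => /andP[a1 a2]; rewrite indicE mem_setE in_itv/=.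
  have [ax|xa] := ltP a x.
    rewrite mulr1 integral_sector_form_y ?subr_gt0//.
    by move: xM; rewrite ler_norml; lra.
  rewrite mulr0 integral0_eq// => b _; rewrite sector_form_out//.
  by apply: le_trans (normr_ge0 _); rewrite subr_le0.
have half : (lebesgue_measure (`]-oo, x[ `&` `[(- M)%R, M]) = (x + M)%:E)%E.
  move: xM; rewrite ler_norml => /andP[x1 x2].
  rewrite (_ : _ `&` _ = `[- M, x[%classic); last first.
    apply/seteqP; split=> a /=; rewrite !in_itv/=.
      by move=> [ax /andP[-> _]].
    by move=> /andP[-> ax]; split => //=; lra.
  rewrite lebesgue_measure_itv/= lte_fin; case: ltP => h; first by rewrite -EFinB opprK.
  by congr EFin; lra.
have total : (\int[lebesgue_measure]_(a in `[(- M)%R, M]) (\1_(`]-oo, x[) a)%:E = (x + M)%:E)%E.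
  by rewrite integral_indic.
(* The velocity [(0, 1)] gives a nonnegative kernel, so Tonelli decides its integrability; by
   [sector_form_le] it dominates the form for all velocities. *)
have int1 : mu2.-integrable box (fun z => (sector_form (x - z.1) (y - z.2) 0 1)%:E).
  apply/integrableP; split; first by apply: measurable_funTS; exact: mform.
  under eq_integral do rewrite gee0_abs ?lee_fin ?sector_form_ge0//.
  rewrite tonelli_rectangle; [|exact: mM|exact: mL|exact: mform
    |by move=> z; rewrite lee_fin sector_form_ge0].
  under eq_integral => a aM.
    rewrite inE/= in aM; rewrite slice// mul1r.
    over.
  by rewrite total ltry.
have int2 : mu2.-integrable box (fun z => (sector_form (x - z.1) (y - z.2) p q)%:E).
  have int1' := integrableZl mbox (`|p| + `|q|) int1.
  apply: le_integrable int1' => //; first by apply: measurable_funTS; exact: mform.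
  move=> z _.
  rewrite /= !lee_fin; apply: le_trans (sector_form_le _ _ _ _) _.
  exact: ler_norm.
split=> //; have [_ -> _] := fubini_rectangle mM mL int2.
under eq_integral => a aM.
  rewrite inE/= in aM; rewrite slice// EFinM.
  over.
rewrite /= integralZl//; first by rewrite total.
apply/integrableP; split.
  by apply/measurable_EFinP; apply: measurable_indic; exact: measurable_itv.
under eq_integral do rewrite gee0_abs ?lee_fin//.
by rewrite total ltry.
Qed.

End sector_measurable.

(** * Lebesgue measure of the plane *)

Section plane_measure.
Context {R : realType}.
Local Notation plane := (measurableTypeR R * measurableTypeR R)%type.
Local Open Scope ereal_scope.

(* Products of measures are canonically s-finite only for subprobabilities, hence
   this copy of the product measure, declared sigma-finite below. *)
Definition plane_measure : set plane -> \bar R :=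
  @lebesgue_measure R \x @lebesgue_measure R.

Let plane_measure0 : plane_measure set0 = 0.
Proof. exact: measure0. Qed.

Let plane_measure_ge0 A : 0 <= plane_measure A.
Proof. exact: measure_ge0. Qed.

Let plane_measure_sigma_additive : semi_sigma_additive plane_measure.
Proof. exact: measure_semi_sigma_additive. Qed.

HB.instance Definition _ := isMeasure.Build _ _ _ plane_measure
  plane_measure0 plane_measure_ge0 plane_measure_sigma_additive.

Definition square (r : R) : set plane := `[(- r)%R, r] `*` `[(- r)%R, r].

Lemma plane_measureX (A B : set (measurableTypeR R)) : measurable A -> measurable B ->
  plane_measure (A `*` B) = lebesgue_measure A * lebesgue_measure B.
Proof. exact: product_measure1E. Qed.

Let plane_measure_sigma_finite : sigma_finite setT plane_measure.
Proof.
exists (fun n => square n%:R).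
  apply/seteqP; split=> // -[a b] _.
  have [n nab] : exists n, (`|a| + `|b| < n%:R)%R.
    by exists (Num.bound (`|a| + `|b|)); rewrite archi_boundP// addr_ge0.
  exists n => //; rewrite /square /= !in_itv/= -!ler_norml.
  by split; apply/ltW; apply: le_lt_trans nab; rewrite ?lerDl ?lerDr.
move=> n; split; first by apply: measurableX; exact: measurable_itv.
rewrite plane_measureX; [|exact: measurable_itv|exact: measurable_itv].
rewrite lebesgue_measure_itv/=; case: ifP => _; last by rewrite mul0e.
by rewrite -EFinB -EFinM ltry.
Qed.

HB.instance Definition _ := Measure_isSigmaFinite.Build _ _ _ plane_measure
  plane_measure_sigma_finite.

End plane_measure.

Section winding_integral.
Context {R : realType}.
Local Notation mu := (@lebesgue_measure R).
Local Notation mu2 := (@plane_measure R).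
Local Notation plane := (measurableTypeR R * measurableTypeR R)%type.

(** For a curve within distance [M] of both axes, a sector reaches horizontally at most [2 * M]
    inside the box, hence vertically at most [2 * M] from an ordinate bounded by [M]. *)
Definition box (M : R) : set plane := `[- M, M] `*` `[- (3 * M), 3 * M].

Lemma measurable_box M : measurable (box M).
Proof. by apply: measurableX; exact: measurable_itv. Qed.

Lemma measurable_arc_form (g : @plane_arc R) :
  continuous (arcx g) -> continuous (arcy g) -> continuous (arcdx g) -> continuous (arcdy g) ->
  measurable_fun setT (fun z : plane * measurableTypeR R => (arc_form g z.1 z.2)%:E).
Proof.
move=> cX cY cP cQ; apply/measurable_EFinP; apply: measurable_sector_form.
- apply: measurable_funB.
    by apply: measurableT_comp (continuous_measurable_fun cX) _; exact: measurable_snd.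
  by apply: measurableT_comp (@measurable_fst _ _ _ _) _; exact: measurable_fst.
- apply: measurable_funB.
    by apply: measurableT_comp (continuous_measurable_fun cY) _; exact: measurable_snd.
  by apply: measurableT_comp (@measurable_snd _ _ _ _) _; exact: measurable_fst.
- by apply: measurableT_comp (continuous_measurable_fun cP) _; exact: measurable_snd.
- by apply: measurableT_comp (continuous_measurable_fun cQ) _; exact: measurable_snd.
Qed.

(** Fubini exchanges time and base point. Joint integrability comes from Tonelli: at time [t] the
    inner integral of the absolute value is at most the sum of the absolute velocities times
    [arcx g t + M]. *)
Lemma integral_arc_form (c d M : R) (x y : R -> R) (g : @plane_arc R) : c <= d ->
  arc_on c d x y g -> (forall t, c <= t <= d -> `|x t| <= M /\ `|y t| <= M) ->
  let W z := (\int[mu]_(t in `[c, d]) (arc_form g z t)%:E)%E in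
  mu2.-integrable (box M) W /\
  (\int[mu2]_(z in box M) W z =
    (\int[mu]_(t in `[c, d]) (arcdy g t * (arcx g t + M))%R)%:E)%E.
Proof.
move=> cd [[cX cY cP cQ] dX dY xE yE] xyM W.
have mcd : measurable (`[c, d] : set (measurableTypeR R)) by exact: measurable_itv.
have mB := measurable_box M.
have mf := measurable_arc_form cX cY cP cQ.
have tbox t : c <= t <= d -> `|arcx g t| <= M /\ `|arcy g t| + 2 * M <= 3 * M.
  by move=> tcd; have [? ?] := xyM t tcd; rewrite xE// yE//; split => //; lra.
have cont : {within `[c, d], continuous (fun t => arcdy g t * (arcx g t + M))}.
  apply: continuous_subspaceT => t; apply: cvgM; first exact: cQ.
  by apply: cvgD; [exact: cX|exact: cvg_cst].
have cont2 : {within `[c, d], continuous (fun t => (`|arcdx g t| + `|arcdy g t|) * (arcx g t + M))}.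
  apply: continuous_subspaceT => t; apply: cvgM.
    by apply: cvgD; apply: cvg_norm; [exact: cP|exact: cQ].
  by apply: cvgD; [exact: cX|exact: cvg_cst].
have int_cd h : {within `[c, d], continuous h} -> mu.-integrable `[c, d] (EFin \o h).
  by move=> ch; apply: continuous_compact_integrable => //; exact: segment_compact.
have int : (mu2 \x mu)%E.-integrable (box M `*` `[c, d]) (fun z => (arc_form g z.1 z.2)%:E).
  apply/integrableP; split; first by apply: measurable_funTS; exact: mf.
  have mabs : measurable_fun setT (fun z : plane * measurableTypeR R => `|(arc_form g z.1 z.2)%:E|%E).
    by apply: measurableT_comp; [exact: abse_measurable|exact: mf].
  rewrite (tonelli_rectangle2 mu2 mu mB mcd mabs (fun z => abse_ge0 _)).
  have int2 := int_cd _ cont2; have /integrableP[m2 fin2] := int2.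
  apply: le_lt_trans fin2; apply: ge0_le_integral => //.
  - by move=> t _; apply: integral_ge0 => z _; exact: abse_ge0.
  - apply: measurable_funTS.
    have -> : (fun t => \int[mu2]_(z in box M) `|(arc_form g z t)%:E|)%E =
        fubini_G mu2 ((fun z : plane * measurableTypeR R =>
          `|(arc_form g z.1 z.2)%:E|%E) \_ (box M `*` setT)).
      by rewrite fubini_G_patch patch_setT.
    apply: measurable_fun_fubini_tonelli_G.
      apply/(measurable_restrictT _ (measurableX mB measurableT)).
      exact: measurable_funTS.
    by move=> z; rewrite patchE; case: ifP => // _; exact: abse_ge0.
  - by apply: measurableT_comp => //; exact: abse_measurable.
  move=> t; rewrite /= in_itv/= => tcd; have [xM yM] := tbox t tcd.
  have [/integrableP[mpq _] _] := integral_sector_form_box (arcdx g t) (arcdy g t) xM yM.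
  have [/integrableP[m01 _] e01] := integral_sector_form_box 0 1 xM yM.
  apply: (@le_trans _ _ (\int[mu2]_(z in box M) ((`|arcdx g t| + `|arcdy g t|)%:E *
      (sector_form (arcx g t - z.1) (arcy g t - z.2) 0 1)%:E))%E).
    apply: ge0_le_integral => //.
    - exact: (measurableT_comp (@abse_measurable R setT) mpq).
    - exact: measurable_funeM.
    - by move=> z _; rewrite /= -EFinM lee_fin; exact: sector_form_le.
  rewrite ge0_integralZl//; last first.
    by move=> z _; rewrite lee_fin sector_form_ge0.
  by rewrite e01 mul1r -EFinM lee_fin ler_norm.
have [int1 e1 e2] := fubini_rectangle mB mcd int.
split => //; rewrite [LHS]e2 /Rintegral fineK; last first.
  by apply: integrable_fin_num => //; exact: int_cd cont.
apply: eq_integral => t; rewrite inE/= in_itv/= => tcd.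
have [xM yM] := tbox t tcd.
by have [_] := integral_sector_form_box (arcdx g t) (arcdy g t) xM yM.
Qed.

End winding_integral.

(** * Integral of the winding number as a line integral *)

Section green_formula.
Context {R : realType}.
Local Notation mu := (@lebesgue_measure R).
Local Notation mu2 := (@plane_measure R).
Local Notation plane := (measurableTypeR R * measurableTypeR R)%type.
Variables (n : nat) (s : nat -> R) (x y : R -> R) (g : nat -> @plane_arc R).
Hypothesis sg : subdivided_curve n s x y g.
Hypothesis closed_curve : (x (s n), y (s n)) = (x (s 0%N), y (s 0%N)).

Definition line_integral : R :=
  \sum_(i < n) \int[mu]_(t in `[s i, s i.+1]) (arcx (g i) t * arcdy (g i) t).

Lemma line_integral_shift (M : R) :
  \sum_(i < n) \int[mu]_(t in `[s i, s i.+1]) (arcdy (g i) t * (arcx (g i) t + M)) =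
  line_integral.
Proof.
rewrite /line_integral; transitivity (\sum_(i < n)
  (\int[mu]_(t in `[s i, s i.+1]) (arcx (g i) t * arcdy (g i) t) +
   M * (y (s i.+1) - y (s i)))).
  apply: eq_bigr => -[i /= ni] _; have [/ltW si [[cX cY cP cQ] dX dY xE yE]] := sg ni.
  have int h : continuous h -> mu.-integrable `[s i, s i.+1] (EFin \o h).
    move=> ch; apply: continuous_compact_integrable; first exact: segment_compact.
    exact: continuous_subspaceT.
  have cXQ : continuous (fun t => arcx (g i) t * arcdy (g i) t).
    by move=> t; apply: cvgM; [exact: cX|exact: cQ].
  have cMQ : continuous (fun t => M * arcdy (g i) t).
    by move=> t; apply: cvgM; [exact: cvg_cst|exact: cQ].
  under eq_Rintegral do rewrite mulrDr (mulrC _ M) (mulrC _ (arcx _ _)).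
  rewrite RintegralD//; [|exact: int|exact: int].
  rewrite RintegralZl//; last exact: int.
  rewrite (Rintegral_derive si (continuous_subspaceT cQ) dY) !yE//.
    by rewrite lexx.
  by rewrite lexx si.
rewrite big_split/= -mulr_sumr -(big_mkord xpredT (fun i => y (s i.+1) - y (s i))).
by rewrite telescope_sumr//; case: closed_curve => _ ->; rewrite subrr mulr0 addr0.
Qed.

(** [W] sums extended-real integrals over the pieces, which is what Fubini delivers at all base
    points. Off the curve these integrals are finite and add up to the winding number. *)
Lemma integral_winding (M : R) :
  (forall t, s 0%N <= t <= s n -> `|x t| <= M /\ `|y t| <= M) ->
  exists W : plane -> \bar R, [/\ mu2.-integrable (box M) W,
    (\int[mu2]_(z in box M) W z = line_integral%:E)%E &
    forall z, off_curve n s x y z -> W z = (winding n s g z)%:E].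
Proof.
move=> xyM.
pose W (i : 'I_n) (z : plane) := (\int[mu]_(t in `[s i, s i.+1]) (arc_form (g i) z t)%:E)%E.
have HW (i : 'I_n) : mu2.-integrable (box M) (W i) /\
  (\int[mu2]_(z in box M) W i z =
    (\int[mu]_(t in `[s i, s i.+1]) (arcdy (g i) t * (arcx (g i) t + M))%R)%:E)%E.
  have [/ltW si gi] := sg (ltn_ord i).
  by apply: (integral_arc_form si gi) => t ti; apply: xyM; exact: (subdivision_itv sg (ltn_ord i) ti).
exists (fun z => (\sum_(i < n) W i z)%R); split.
- by apply: integrable_sum; [exact: measurable_box|move=> i _; exact: (HW i).1].
- rewrite integral_sum; [|exact: measurable_box|by move=> i; exact: (HW i).1].
  by rewrite -(line_integral_shift M) -sumEFin; apply: eq_bigr => i _; exact: (HW i).2.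
move=> z oz; rewrite /winding -sumEFin; apply: eq_bigr => i _.
rewrite /Rintegral fineK//; apply: integrable_fin_num => //.
apply: continuous_compact_integrable; first exact: segment_compact.
exact: (arc_form_within sg (ltn_ord i) oz).
Qed.

End green_formula.

(** * Winding number and indicator of the region *)

(** The trace of [U] on [A] is nonempty, open, and equal to the trace of the closure of [U], hence
    closed in [A]. *)
Lemma connected_avoiding_boundary (T : topologicalType) (A U : set T) :
  connected A -> open U -> A `&` U !=set0 ->
  (forall z, A z -> closure U z -> U z) -> A `<=` U.
Proof.
move=> cA oU AU h; have <- := cA (A `&` U) AU _ _; first by move=> z [].
- by exists U.
- exists (closure U); first exact: closed_closure.
  by apply/seteqP; split=> z [Az Uz]; split => //; [exact: subset_closure|exact: h].
Qed.

Lemma nbhs_box (R : realType) (z : R * R) (U : set (R * R)) : nbhs z U ->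
  exists2 r, 0 < r & forall w, `|w.1 - z.1| < r -> `|w.2 - z.2| < r -> U w.
Proof.
move=> /nbhs_ballP[r /= r0 H]; exists r => // w w1 w2; apply: H.
by split; rewrite /ball/= distrC.
Qed.

Lemma box_nbhs (R : realType) (z : R * R) (U : set (R * R)) (r : R) : 0 < r ->
  (forall w, `|w.1 - z.1| < r -> `|w.2 - z.2| < r -> U w) -> nbhs z U.
Proof.
move=> r0 H; apply/nbhs_ballP; exists r => // w [w1 w2].
by apply: H; rewrite distrC.
Qed.

(** Here [(P, Q)] is the tangent and [k] bounds the deviation from it. Pairing the displacement with
    the normal [(- Q, P)] cancels the tangent part and bounds [e * Q ^+ 2] by [k] times [h] times
    the size of [(P, Q)]; the second coordinate bounds [h] by a multiple of [e]. After division by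
    [e] this contradicts the smallness of [k]. *)
Lemma tangent_cone_avoided (R : realType) (P Q e v h k : R) : Q != 0 -> 0 < e ->
  0 <= v <= 1 -> 0 < k -> k <= `|Q| / 2 -> 4 * k * (`|P| + 1) * (`|P| + `|Q|) <= `|Q| ^+ 3 ->
  `|- (e * Q) - P * h| <= k * `|h| -> `|v * (e * P) - Q * h| <= k * `|h| -> False.
Proof.
move=> Q0 e0 /andP[v0 v1] k0 kQ kPQ hx hy.
have q0 : 0 < `|Q| by rewrite normr_gt0.
have p0 := normr_ge0 P; have h0 := normr_ge0 h.
have e1 : `|Q| * `|h| <= k * `|h| + e * `|P|.
  rewrite -normrM (_ : Q * h = v * (e * P) - (v * (e * P) - Q * h)); last by ring.
  apply: le_trans (ler_normB _ _) _; rewrite addrC lerD//.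
  by rewrite normrM (ger0_norm v0) normrM (gtr0_norm e0) ler_piMl// mulr_ge0// ltW.
have e2 : e * `|Q| ^+ 2 <= k * `|h| * (`|P| + `|Q|).
  have eP : 0 <= v * e * P ^+ 2 by rewrite mulr_ge0 ?sqr_ge0// mulr_ge0// ltW.
  have : e * Q ^+ 2 <= - Q * (- (e * Q) - P * h) + P * (v * (e * P) - Q * h) by lra.
  rewrite real_normK ?num_real// => /le_trans; apply.
  apply: le_trans (ler_norm _) _; apply: le_trans (ler_normD _ _) _.
  rewrite !normrM normrN mulrDr addrC; apply: lerD; rewrite mulrC.
    by rewrite ler_wpM2r.
  by rewrite ler_wpM2r.
move: (`|P|) (`|Q|) (`|h|) p0 q0 h0 kQ kPQ e1 e2 {hx hy Q0} => p q r p0 q0 r0 kq kpq e1 e2.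
have e3 : q * r <= 2 * (e * p).
  have : k * r <= q / 2 * r by rewrite ler_wpM2r.
  lra.
have e4 : e * q ^+ 3 <= k * (p + q) * (2 * (e * p)).
  have : e * q ^+ 2 * q <= k * r * (p + q) * q by rewrite ler_wpM2r// ltW.
  have : k * (p + q) * (q * r) <= k * (p + q) * (2 * (e * p)).
    by rewrite ler_wpM2l// mulr_ge0 ?addr_ge0// ltW.
  move=> h1 h2; rewrite (_ : e * q ^+ 3 = e * q ^+ 2 * q); last by ring.
  by apply: (le_trans h2); move: h1; congr (_ <= _); ring.
have e5 : q ^+ 3 <= 2 * k * p * (p + q).
  by rewrite -(ler_pM2l e0); apply: le_trans e4 _; rewrite le_eqVlt; apply/orP; left; apply/eqP; ring.
have kpq0 : 0 < k * (p + q) by rewrite mulr_gt0// ltr_wpDl.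
have kppq0 : 0 <= k * (p + q) * p by rewrite mulr_ge0// ltW.
lra.
Qed.

Section jordan_region.
Context {R : realType}.
Variables (n : nat) (s : nat -> R) (x y : R -> R) (g : nat -> @plane_arc R).
Hypothesis sg : subdivided_curve n s x y g.
Hypothesis closed_curve : (x (s n), y (s n)) = (x (s 0%N), y (s 0%N)).

Lemma subdivision_cover t : (0 < n)%N -> s 0%N <= t <= s n ->
  exists2 i, (i < n)%N & s i <= t <= s i.+1.
Proof.
move=> n0 /andP[t0 tn].
have H m : (m <= n)%N -> (0 < m)%N -> t <= s m -> exists2 i, (i < n)%N & s i <= t <= s i.+1.
  elim: m => // m IH mn _ tm; have [tm'|tm'] := leP (s m) t; first by exists m; rewrite ?tm'.
  case: m IH mn tm tm' => [|m] IH mn tm tm'; first by rewrite ltNge t0 in tm'.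
  by apply: IH => //; [exact: ltnW|exact: ltW].
by apply: (H n).
Qed.

(** Breakpoints are excluded together with critical points, because the jump of the winding number
    is computed inside a single piece. *)
Definition regular_value (b : R) := forall i t, (i < n)%N -> s i <= t <= s i.+1 ->
  y t = b -> s i < t < s i.+1 /\ arcdy (g i) t != 0.

Variable Omega : set (R * R).
Hypothesis Omega_open : open Omega.
Hypothesis Omega_connected : connected Omega.
Hypothesis Omega_boundary : forall z, closure Omega z /\ ~ Omega z <->
  exists2 t, s 0%N <= t <= s n & (x t, y t) = z.
Hypothesis curve_simple : forall i t t0, (i < n)%N -> s i < t0 < s i.+1 ->
  s 0%N <= t <= s n -> (x t, y t) = (x t0, y t0) -> t = t0.
Hypothesis Omega_left : forall i t, (i < n)%N -> s i < t < s i.+1 ->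
  arcdy (g i) t != 0 -> exists2 r, 0 < r & forall e, 0 < e < r ->
    Omega (x t - e * arcdy (g i) t, y t + e * arcdx (g i) t).
Variable M : R.
Hypothesis Omega_bounded : forall z, Omega z -> z.1 <= M.
Hypothesis curve_bounded : forall t, s 0%N <= t <= s n -> x t <= M.

Local Notation off := (off_curve n s x y).
Local Notation w := (winding n s g).

Lemma off_curveP z : off z -> Omega z \/ ~ closure Omega z.
Proof.
move=> oz; have [Oz|nOz] := pselect (Omega z); [by left|right => cz].
by have [t tn /esym zt] := (Omega_boundary z).1 (conj cz nOz); apply: (oz t tn).
Qed.

Lemma Omega_off z : Omega z -> off z.
Proof. by move=> Oz t tn zt; have [_] := (Omega_boundary z).2 (ex_intro2 _ _ t tn zt). Qed.

Lemma off_curve_nbhs z : off z ->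
  nbhs z (fun u => off u /\ (Omega u <-> Omega z)).
Proof.
move=> oz; have [Oz|nOz] := off_curveP oz.
  have : nbhs z Omega by apply: open_nbhs_nbhs.
  by apply: filterS => u Ou; split; [exact: Omega_off|].
have : nbhs z (~` closure Omega).
  by apply: open_nbhs_nbhs; split => //; exact: closed_openC (@closed_closure _ _).
have nO u : ~ closure Omega u -> ~ Omega u by move=> h /subset_closure.
apply: filterS => u cu; split; last by split => h; [case: (nO u cu)|case: (nO z nOz)].
by move=> t tn zt; have [] := (Omega_boundary u).2 (ex_intro2 _ _ t tn zt).
Qed.

Lemma off_curve_locally z : off z -> exists2 r, 0 < r & forall u,
  `|u.1 - z.1| < r -> `|u.2 - z.2| < r ->
  [/\ off u, Omega u <-> Omega z & w u = w z].
Proof.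
move=> oz; have [r r0 Hr] := nbhs_box (off_curve_nbhs oz).
exists (r / 4) => [|u u1 u2]; first by rewrite divr_gt0.
have h1 : `|u.1 - z.1| < r by lra.
have h2 : `|u.2 - z.2| < r by lra.
have [ou Ou] := Hr u h1 h2; split => //.
apply/esym/(winding_locally_constant sg closed_curve r0 _ u1 u2) => t tn tx.
rewrite leNgt; apply/negP => ty; have [ot _] := Hr (x t, y t) tx ty.
exact: (ot t tn).
Qed.

(** [Omega] is connected and disjoint from the curve, and off the curve the winding number is
    locally constant; so a level set inside [Omega] is open and relatively closed. *)
Lemma winding_Omega z u : Omega z -> Omega u -> w z = w u.
Proof.
move=> Oz Ou; have openE' v : open [set q | off q /\ (Omega q /\ w q = v)].
  rewrite openE => q [oq [Oq wq]]; rewrite /interior/=.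
  have [r r0 Hr] := off_curve_locally oq; apply: (box_nbhs r0) => p p1 p2.
  have [op Op wp] := Hr p p1 p2; split => //; split; first exact/Op.
  by rewrite wp.
suff sub : Omega `<=` [set q | off q /\ (Omega q /\ w q = w u)] by have [_ []] := sub z Oz.
apply: connected_avoiding_boundary => //.
  by exists u; split => //; split => //; exact: Omega_off.
move=> q Oq cq; split; first exact: Omega_off.
split => //; have [r r0 Hr] := off_curve_locally (Omega_off Oq).
have [p [[op [Op wp]] [p1 p2]]] : [set q | off q /\ (Omega q /\ w q = w u)] `&`
    [set p | `|p.1 - q.1| < r /\ `|p.2 - q.2| < r] !=set0.
  by apply: cq; apply: (box_nbhs r0) => p.
by have [_ _ <-] := Hr p p1 p2.
Qed.

Lemma uniform_radius (m : nat) (P : nat -> R -> Prop) :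
  (forall i r r', P i r -> r' <= r -> P i r') ->
  (forall i, (i < m)%N -> exists2 r, 0 < r & P i r) ->
  exists2 r, 0 < r & forall i, (i < m)%N -> P i r.
Proof.
move=> hP; elim: m => [|m IH] H; first by exists 1.
have [|r r0 Hr] := IH; first by move=> i im; apply: H; exact: ltnW.
have [q q0 Hq] := H m (ltnSn m).
exists (Num.min r q); first by rewrite lt_min r0.
move=> i; rewrite ltnS leq_eqVlt => /predU1P[->|im].
  by apply: hP Hq _; rewrite ge_min lexx orbT.
by apply: hP (Hr i im) _; rewrite ge_min lexx.
Qed.

(** By simplicity the distance to the point at [t0] does not vanish on the compact set of times at
    least [d] away, so it has a positive minimum. The maximum norm is used, which gives the
    conclusion coordinate by coordinate. *)
Lemma curve_far i t0 d : (i < n)%N -> s i < t0 < s i.+1 -> 0 < d ->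
  exists2 r, 0 < r & forall t, s 0%N <= t <= s n -> d <= `|t - t0| ->
    `|x t - x t0| < r -> r <= `|y t - y t0|.
Proof.
move=> ni ti d0.
have [r r0 Hr] : exists2 r, 0 < r & forall k, (k < n)%N -> forall t, s k <= t <= s k.+1 ->
    d <= `|t - t0| -> `|x t - x t0| < r -> r <= `|y t - y t0|.
  apply: uniform_radius => [k r r' H rr' t tk td xr|k nk].
    by apply: (le_trans rr'); apply: H => //; exact: lt_le_trans rr'.
  have [_ [[cX cY _ _] _ _ xE yE]] := sg nk.
  pose K := `[s k, s k.+1] `&` [set t | d <= `|t - t0|].
  pose f t := Num.max `|arcx (g k) t - x t0| `|arcy (g k) t - y t0|.
  have [[t1 Kt1]|K0] := pselect (K !=set0); last first.
    exists 1 => // t tk td; case: K0; exists t; split => //=; by rewrite in_itv.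
  have cK : compact K.
    apply: compact_closedI; first exact: segment_compact.
    have -> : [set t | d <= `|t - t0|] = (fun t => `|t - t0|) @^-1` [set u | d <= u] by [].
    apply: closed_comp; last exact: closed_ge.
    move=> t _; apply: cvg_norm; apply: cvgB; [exact: cvg_id|exact: cvg_cst].
  have cf : {within K, continuous f}.
    apply: continuous_subspaceT => t.
    have := @continuous_max R R (fun t => `|arcx (g k) t - x t0|) (fun t => `|arcy (g k) t - y t0|) t.
    apply; apply: cvg_norm; apply: cvgB; try exact: cvg_cst; [exact: cX|exact: cY].
  have [c /[!inE] -[/=]] := compact_EVT_min (ex_intro _ t1 Kt1) cK cf.
  rewrite in_itv/= => ck cd Hc.
  have fE t : s k <= t <= s k.+1 -> f t = Num.max `|x t - x t0| `|y t - y t0|.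
    by move=> tk; rewrite /f xE// yE.
  exists (f c).
    rewrite lt_neqAle eq_sym le_max normr_ge0 andbT; apply/eqP => f0.
    have := subdivision_itv sg nk ck => cn.
    have : c = t0.
      apply: (curve_simple ni ti cn); move: f0; rewrite fE// => f0.
      have h1 : `|x c - x t0| <= 0 by rewrite -f0 le_max lexx.
      have h2 : `|y c - y t0| <= 0 by rewrite -f0 le_max lexx orbT.
      by move: h1 h2; rewrite !normr_le0 !subr_eq0 => /eqP -> /eqP ->.
    by move=> ct; move: cd; rewrite ct subrr normr0 leNgt d0.
  move=> t tk td xf; have : f c <= f t by apply: Hc; rewrite inE; split => //=; rewrite in_itv.
  by rewrite (fE t tk) le_max leNgt xf.
exists r => // t tn; have [|j nj tj] := @subdivision_cover t _ tn; first exact: leq_ltn_trans ni.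
exact: Hr nj t tj.
Qed.

Lemma curve_near i t0 k : (i < n)%N -> s i < t0 < s i.+1 -> 0 < k ->
  exists2 d, 0 < d & forall t, `|t - t0| < d ->
    `|x t - x t0 - arcdx (g i) t0 * (t - t0)| <= k * `|t - t0| /\
    `|y t - y t0 - arcdy (g i) t0 * (t - t0)| <= k * `|t - t0|.
Proof.
move=> ni /andP[t1 t2] k0; have [_ [_ dX dY xE yE]] := sg ni.
have ti : s i <= t0 <= s i.+1 by rewrite !ltW.
have [d1 d10 H1] := is_derive_approx (dX t0 ti) k0.
have [d2 d20 H2] := is_derive_approx (dY t0 ti) k0.
exists (Num.min (Num.min d1 d2) (Num.min (t0 - s i) (s i.+1 - t0))).
  by rewrite !lt_min d10 d20 !subr_gt0 t1.
move=> t; rewrite !lt_min => /andP[/andP[/H1 h1 /H2 h2] /andP[h3 h4]].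
have tt : s i <= t <= s i.+1.
  by move: h3 h4; rewrite !ltr_norml => /andP[? ?] /andP[? ?]; apply/andP; split; lra.
by move: h1 h2; rewrite !xE// !yE.
Qed.

(** At times near [t0] the ordinate moves at least at half the speed it has at [t0]; all other times
    are kept away by [curve_far]. *)
Lemma crossing_isolated i t0 : (i < n)%N -> s i < t0 < s i.+1 -> arcdy (g i) t0 != 0 ->
  exists2 r, 0 < r & forall t, s 0%N <= t <= s n -> y t = y t0 ->
    `|x t - x t0| < r -> t = t0.
Proof.
move=> ni ti Q0; have q0 : 0 < `|arcdy (g i) t0| / 2 by rewrite divr_gt0// normr_gt0.
have [d d0 Hd] := curve_near ni ti q0.
have [r r0 Hr] := curve_far ni ti d0.
exists r => // t tn yt xr; have [td|td] := leP d `|t - t0|.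
  by have := Hr t tn td xr; rewrite yt subrr normr0 leNgt r0.
have [_] := Hd t td; rewrite yt subrr sub0r normrN normrM => H.
apply/eqP; rewrite -subr_eq0 -normr_le0.
by rewrite -(ler_pM2l q0) mulr0; lra.
Qed.

(** Turns the orientation hypothesis, stated along the normal, into one along the horizontal line.
    The two displaced points are joined by a vertical segment; it misses the curve, so it stays in
    [Omega]. *)
Lemma crossing_left i t0 : (i < n)%N -> s i < t0 < s i.+1 -> arcdy (g i) t0 != 0 ->
  exists2 r, 0 < r & forall d, 0 < d < r ->
    Omega (x t0 - Num.sg (arcdy (g i) t0) * d, y t0).
Proof.
move=> ni ti Q0; set Q := arcdy (g i) t0 in Q0 *; set P := arcdx (g i) t0.
have q0 : 0 < `|Q| by rewrite normr_gt0.
have p0 := normr_ge0 P.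
have pq0 : 0 < (`|P| + 1) * (`|P| + `|Q|) by rewrite mulr_gt0// ltr_wpDl.
(* Both arguments are the smallness conditions of [tangent_cone_avoided]; the [+ 1] keeps the
   denominator comfortably large also when [P = 0]. *)
pose k := Num.min (`|Q| / 2) (`|Q| ^+ 3 / (4 * ((`|P| + 1) * (`|P| + `|Q|)))).
have k0 : 0 < k by rewrite lt_min !divr_gt0 ?exprn_gt0// mulr_gt0.
have kQ : k <= `|Q| / 2 by rewrite ge_min lexx.
have kPQ : 4 * k * (`|P| + 1) * (`|P| + `|Q|) <= `|Q| ^+ 3.
  have : k <= `|Q| ^+ 3 / (4 * ((`|P| + 1) * (`|P| + `|Q|))) by rewrite ge_min lexx orbT.
  rewrite ler_pdivlMr; last exact: mulr_gt0.
  move=> h; apply: le_trans h; rewrite le_eqVlt.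
  by apply/orP; left; apply/eqP; ring.
have [d d0 Hd] := curve_near ni ti k0.
have [r1 r10 Hr1] := curve_far ni ti d0.
have [r2 r20 Hr2] := Omega_left ni ti Q0.
exists (`|Q| * Num.min r2 (r1 / (`|P| + `|Q|))).
  by rewrite mulr_gt0// lt_min r20 divr_gt0// ltr_wpDl.
move=> c /andP[c0 cr]; pose e := c / `|Q|.
have e0 : 0 < e by rewrite divr_gt0.
have : e < Num.min r2 (r1 / (`|P| + `|Q|)) by rewrite ltr_pdivrMr// mulrC.
rewrite lt_min ltr_pdivlMr ?ltr_wpDl// => /andP[er2 er1].
have -> : Num.sg Q * c = e * Q.
  by rewrite {2}[Q]numEsg /e; field; rewrite gt_eqF.
have eQ : `|e * Q| < r1.
  rewrite normrM (gtr0_norm e0); apply: le_lt_trans er1; rewrite mulrDr lerDr.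
  by rewrite mulr_ge0// ltW.
have eP : `|e * P| < r1.
  rewrite normrM (gtr0_norm e0); apply: le_lt_trans er1; rewrite mulrDr lerDl.
  by rewrite mulr_ge0// ltW.
(* The vertical segment: [v = 1] is the point on the left normal, [v = 0] the horizontally displaced
   one. *)
pose f v := (x t0 - e * Q, y t0 + v * (e * P)).
have cf : continuous f.
  move=> v; have c1 : {for v, continuous (cst (x t0 - e * Q) : R -> R)} by exact: cvg_cst.
  have c2 : {for v, continuous (fun v : R => y t0 + v * (e * P) : R)}.
    by apply: cvgD; [exact: cvg_cst|apply: cvgM; [exact: cvg_id|exact: cvg_cst]].
  exact: (cvg_pair c1 c2).
have cA : connected (f @` `[0, 1]).
  apply: connected_continuous_connected; first exact: segment_connected.
  exact: continuous_subspaceT.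
suff sub : f @` `[0, 1] `<=` Omega.
  have := sub (f 0); rewrite /f mul0r addr0; apply.
  by exists 0; rewrite ?mul0r ?addr0//= in_itv/= lexx ler01.
apply: connected_avoiding_boundary => //.
  exists (f 1); split; first by exists 1 => //=; rewrite in_itv/= lexx ler01.
  by rewrite /f mul1r; apply: Hr2; rewrite e0.
move=> z [v]; rewrite /= in_itv/= => v01 <-{z} cz; apply: contrapT => nO.
have [t tn [xt yt]] := (Omega_boundary _).1 (conj cz nO).
have veP : `|v * (e * P)| < r1.
  apply: le_lt_trans eP; rewrite normrM ler_piMl//.
  by case/andP: v01 => v0 v1; rewrite ger0_norm.
have xE : x t - x t0 = - (e * Q) by rewrite xt; ring.
have yE : y t - y t0 = v * (e * P) by rewrite yt; ring.
have [td|td] := leP d `|t - t0|.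
  have := Hr1 t tn td; rewrite xE yE normrN => /(_ eQ).
  by rewrite leNgt veP.
have [hx hy] := Hd t td; rewrite xE in hx; rewrite yE in hy.
exact: (tangent_cone_avoided Q0 e0 v01 k0 kQ kPQ hx hy).
Qed.

Local Notation defect a b := (\1_Omega (a, b) - w (a, b)).

(** The left side of the crossing lies in [Omega]. On the right side the winding number differs by
    one, so by [winding_Omega] that side is outside [Omega], and the jumps of indicator and winding
    number cancel. *)
Lemma defect_near_crossing i t0 : (i < n)%N -> s i < t0 < s i.+1 -> arcdy (g i) t0 != 0 ->
  exists c, exists2 r, 0 < r & forall a, `|a - x t0| < r -> a != x t0 ->
    off (a, y t0) /\ defect a (y t0) = c.
Proof.
move=> ni ti Q0; have [r1 r10 H1] := crossing_isolated ni ti Q0.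
have [r2 r20 H2] := crossing_left ni ti Q0.
pose r := Num.min r1 r2; have r0 : 0 < r by rewrite lt_min r10.
have rr1 : r <= r1 by rewrite ge_min lexx.
have rr2 : r <= r2 by rewrite ge_min lexx orbT.
set a0 := x t0; set b := y t0.
have jump d d' : 0 < d < r -> 0 < d' < r ->
    w (a0 - d, b) - w (a0 + d', b) = Num.sg (arcdy (g i) t0).
  move=> /andP[d0 dr] /andP[d'0 d'r].
  apply: (winding_jump sg closed_curve ni ti) => //; first by rewrite -/a0; lra.
  by move=> t tn yt /andP[h1 h2]; apply: H1 => //; rewrite ltr_norml -/a0; lra.
have offa a : `|a - a0| < r -> a != a0 -> off (a, b).
  move=> ar aa0 t tn [xt yt]; move/eqP: aa0; apply.
  by rewrite -xt (H1 t tn yt)// xt; apply: lt_le_trans rr1.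
have half : 0 < r / 2 < r by lra.
have inO z : Omega z -> \1_Omega z = 1 :> R by move=> Oz; rewrite indicE mem_set.
have outO z : ~ Omega z -> \1_Omega z = 0 :> R by move=> Oz; rewrite indicE memNset.
move: Q0; rewrite neq_lt => /orP[Q0|Q0].
  have left d : 0 < d < r -> Omega (a0 + d, b).
    move=> dr; have := H2 d; rewrite ltr0_sg// mulN1r opprK; apply.
    by case/andP: dr => -> /lt_le_trans ->.
  exists (1 - w (a0 + r / 2, b)), r => // a ar aa0; split; first exact: offa.
  move: ar; rewrite ltr_norml => /andP[h1 h2].
  have [h|h] := ltP a0 a.
    have dr : 0 < a - a0 < r by lra.
    have := left _ dr; rewrite subrKC => Oa.
    by rewrite inO// (winding_Omega Oa (left _ half)).
  have dr : 0 < a0 - a < r by rewrite subr_gt0 lt_neqAle aa0 h/=; lra.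
  have := jump _ _ dr half; rewrite subKr ltr0_sg// => J.
  have nO : ~ Omega (a, b) by move=> Oa; have := winding_Omega Oa (left _ half); lra.
  by rewrite outO//; lra.
have left d : 0 < d < r -> Omega (a0 - d, b).
  move=> dr; have := H2 d; rewrite gtr0_sg// mul1r; apply.
  by case/andP: dr => -> /lt_le_trans ->.
exists (1 - w (a0 - r / 2, b)), r => // a ar aa0; split; first exact: offa.
move: ar; rewrite ltr_norml => /andP[h1 h2].
have [h|h] := ltP a a0.
  have dr : 0 < a0 - a < r by lra.
  have := left _ dr; rewrite subKr => Oa.
  by rewrite inO// (winding_Omega Oa (left _ half)).
have dr : 0 < a - a0 < r by rewrite subr_gt0 lt_neqAle eq_sym aa0 h/=; lra.
have := jump _ _ half dr; rewrite subrKC gtr0_sg// => J.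
have nO : ~ Omega (a, b) by move=> Oa; have := winding_Omega Oa (left _ half); lra.
by rewrite outO//; lra.
Qed.

(** [c] is the value of the defect on a punctured neighbourhood of [a0]. It exists whether or not
    [a0] is on the curve, and off the curve it is the defect itself. *)
Lemma defect_near a0 b : (0 < n)%N -> regular_value b ->
  exists c, exists2 r, 0 < r & (forall a, `|a - a0| < r -> a != a0 ->
    off (a, b) /\ defect a b = c) /\ (off (a0, b) -> defect a0 b = c).
Proof.
move=> n0 rb; have [ob|nb] := pselect (off (a0, b)).
  have [r r0 Hr] := off_curve_locally ob.
  exists (defect a0 b), r => //; split => // a ar _.
  have [|oa Oa wa] := Hr (a, b) ar; first by rewrite subrr normr0.
  split => //; rewrite wa !indicE; congr (_%:R - _); congr nat_of_bool.
  by apply/idP/idP; rewrite !inE => /Oa.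
have [t0 [tn [xt yt]]] : exists t0, s 0%N <= t0 <= s n /\ (x t0, y t0) = (a0, b).
  apply: contrapT => h; apply: nb => t tn zt; apply: h; by exists t.
have [i ni ti] := subdivision_cover n0 tn.
have [ti' Q0] := rb i t0 ni ti yt.
have [c [r r0 H]] := defect_near_crossing ni ti' Q0.
exists c, r => //; rewrite -xt -yt; split => // h.
by case: (h t0 tn).
Qed.

(** The punctured value of the defect is a locally constant function of the abscissa on the whole
    line, hence constant; far to the right it is 0. *)
Lemma winding_indicator a b : (0 < n)%N -> regular_value b -> off (a, b) ->
  w (a, b) = \1_Omega (a, b).
Proof.
move=> n0 rb oab; have [c Hc] := choice (fun a0 => defect_near a0 n0 rb).
have c_cst : forall u v, c u = c v.
  apply: locally_constant_cst => u; have [r r0 [Hr _]] := Hc u.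
  exists r => // v vu; have [->//|vu'] := eqVneq v u.
  have [q q0 [Hq Hq']] := Hc v.
  by have [ov <-] := Hr v vu vu'; rewrite Hq'.
have far : off (M + 1, b).
  by move=> t tn [xt _]; have := curve_bounded tn; rewrite xt; lra.
have defect0 : defect (M + 1) b = 0.
  rewrite indicE memNset; last by move/Omega_bounded => /=; lra.
  rewrite (winding_right sg) ?subrr//= => t tn.
  by have := curve_bounded tn; lra.
have [_ _ [_ Ha]] := Hc a; have [_ _ [_ HM]] := Hc (M + 1).
by apply/eqP; rewrite eq_sym -subr_eq0 Ha// (c_cst a (M + 1)) -HM// defect0.
Qed.

End jordan_region.

(** * Null sets and area *)

Section null_sets.
Context {R : realType}.
Local Notation mu := (@lebesgue_measure R).
Local Notation mu2 := (@plane_measure R).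
Local Notation plane := (measurableTypeR R * measurableTypeR R)%type.

(** Continuous induction on the supremum of the endpoints reached from [a]. It turns a local
    estimate that is additive over adjacent intervals into a global one, with no explicit
    partition. *)
Lemma itv_creeping (P : R -> R -> Prop) (a b : R) : a <= b ->
  (forall t, a <= t <= b -> exists2 r, 0 < r & forall c d,
    a <= c -> c <= t -> t <= d -> d <= b -> d - c < r -> P c d) ->
  (forall c m d, a <= c -> c <= m -> m <= d -> d <= b -> P c m -> P m d -> P c d) -> P a b.
Proof.
move=> ab loc cat.
pose S := [set u | a <= u <= b /\ P a u].
have Sa : S a.
  have [|r r0 H] := loc a; first by rewrite lexx.
  by split; [rewrite lexx|apply: H; rewrite ?subrr].
have bS : ubound S b by move=> u [/andP[]].
have supS : has_sup S by split; [exists a|exists b].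
have am : a <= sup S by exact: sup_upper_bound.
have mb : sup S <= b by apply: ge_sup => //; exists a.
have [|r r0 H] := loc (sup S); first by rewrite am.
have r20 : 0 < r / 2 by rewrite divr_gt0.
have [u [/andP[au ub] Pau] um] := sup_adherent r20 supS.
have us : u <= sup S by apply: sup_upper_bound => //; split => //; rewrite au.
(* Since [u] is less than [r / 2] below the supremum and [v] at most [r / 3] above it, the interval
   from [u] to [v] is shorter than [r]. *)
pose v := Num.min b (sup S + r / 3).
have vb : v <= b by rewrite ge_min lexx.
have sv : sup S <= v by rewrite le_min mb lerDl divr_ge0// ltW.
have vr : v <= sup S + r / 3 by rewrite ge_min lexx orbT.
have Pav : P a v.
  by apply: (cat a u v) => //; [exact: le_trans sv|apply: H => //; lra].
have : v <= sup S.
  by apply: sup_upper_bound => //; split => //; rewrite vb (le_trans am).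
rewrite ge_min => /orP[bs|]; last by lra.
have <- // : v = b.
by apply/eqP; rewrite eq_le vb (le_trans bs sv).
Qed.

(** An open set is the countable union of the boxes with rational centre and radius that it
    contains; the others are replaced by the empty set, so that all triples may index the union. *)
Lemma measurable_open_plane (U : set plane) : open (U : set (R * R)) -> measurable U.
Proof.
move=> oU.
pose B (p q r : rat) : set plane :=
  [set z | ratr p - ratr r <= z.1 <= ratr p + ratr r /\ ratr q - ratr r <= z.2 <= ratr q + ratr r].
pose C p q r := if pselect (B p q r `<=` U) then B p q r else set0.
have -> : U = \bigcup_p \bigcup_q \bigcup_r C p q r.
  apply/seteqP; split=> z; last first.
    by move=> [p _ [q _ [r _]]]; rewrite /C; case: pselect => // h; exact: h.
  move=> Uz; have : nbhs (z : R * R) U by exact: open_nbhs_nbhs.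
  move=> /nbhs_box[e e0 He].
  have [|r] := @rat_in_itvoo R 0 (e / 2); first by rewrite divr_gt0.
  rewrite in_itv/= => /andP[r0 re].
  have [|p] := @rat_in_itvoo R (z.1 - ratr r) z.1; first by rewrite gtrBl.
  rewrite in_itv/= => /andP[p1 p2].
  have [|q] := @rat_in_itvoo R (z.2 - ratr r) z.2; first by rewrite gtrBl.
  rewrite in_itv/= => /andP[q1 q2].
  exists p => //; exists q => //; exists r => //; rewrite /C; case: pselect => h.
    by split; apply/andP; split; lra.
  case: h => u [/andP[? ?] /andP[? ?]]; apply: He; rewrite ltr_norml; lra.
apply: bigcupT_measurable_rat => p; apply: bigcupT_measurable_rat => q.
apply: bigcupT_measurable_rat => r; rewrite /C; case: pselect => //= BU.
have -> : B p q r = `[ratr p - ratr r, ratr p + ratr r] `*` `[ratr q - ratr r, ratr q + ratr r].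
  by apply/seteqP; split=> z; rewrite /B /= !in_itv.
by apply: measurableX; exact: measurable_itv.
Qed.

Lemma measurable_compact_plane (K : set plane) : compact (K : set (R * R)) -> measurable K.
Proof.
move=> cK; rewrite -(setCK K); apply: measurableC; apply: measurable_open_plane.
by apply: closed_openC; apply: compact_closed => //; exact: norm_hausdorff.
Qed.

(** One-dimensional Sard. Near a critical point the derivative is at most [e], so an interval of
    length [h] has its image in one of length [2 * e * h]; near any other point there are no
    critical points. *)
Lemma critical_values_null (F G : R -> R) (a b : R) : a <= b ->
  continuous G -> (forall t, a <= t <= b -> is_derive t 1 F (G t)) ->
  let Z := F @` (`[a, b] `&` [set t | G t = 0]) in measurable Z /\ mu Z = 0%E.
Proof.
move=> ab cG dF Z.
pose K c d := F @` (`[c, d] `&` [set t | G t = 0]).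
have cF c d : a <= c -> d <= b -> {within `[c, d], continuous F}.
  move=> ac db; apply: continuous_in_subspaceT => t; rewrite inE/= in_itv/= => /andP[ct td].
  by apply: (is_derive_continuous (dF t _)); rewrite (le_trans ac)//= (le_trans td).
have mK c d : a <= c -> d <= b -> measurable (K c d).
  move=> ac db; apply: compact_measurable; apply: continuous_compact.
    by apply: continuous_subspaceW (cF c d ac db); exact: subIsetl.
  apply: compact_closedI; first exact: segment_compact.
  have -> : [set t | G t = 0] = G @^-1` [set 0] by [].
  apply: closed_comp; first by move=> t _; exact: cG.
  by apply: accessible_closed_set1; apply: hausdorff_accessible; exact: Rhausdorff.
split; first exact: mK.
have small e : 0 < e -> (mu Z <= (2 * e * (b - a))%:E)%E.
  move=> e0.
  apply: (@itv_creeping (fun c d => (mu (K c d) <= (2 * e * (d - c))%:E)%E)) => //.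
    move=> t tab; have e'0 : 0 < (if G t == 0 then e else `|G t|).
      by case: eqVneq => // Gt; rewrite normr_gt0.
    have [r r0 Hr] := continuous_nbhs_dist (cG t) e'0.
    exists r => // c d ac ct td db cdr.
    have cd : c <= d by exact: le_trans td.
    have near u : c <= u <= d -> `|u - t| < r.
      by move=> /andP[cu ud]; rewrite ltr_norml; apply/andP; split; lra.
    move: Hr {e'0}; case: (eqVneq (G t) 0) => Gt Hr; last first.
      rewrite (_ : K c d = set0).
        rewrite measure0 lee_fin; apply: mulr_ge0; last by rewrite subr_ge0.
        by rewrite mulr_ge0// ltW.
      apply/seteqP; split=> // v [u [/= uc Gu] _]; move: uc; rewrite in_itv/= => /near/Hr.
      by rewrite Gu sub0r normrN ltxx.
    have Gu u : c <= u <= d -> `|G u| <= e.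
      by move=> /near/Hr; rewrite Gt subr0 => /ltW.
    have Fu u : c <= u <= d -> `|F u - F t| <= e * (d - c).
      move=> /andP[cu ud].
      have inc p q : c <= p -> p <= q -> q <= d -> `|F q - F p| <= e * (d - c).
        move=> cp pq qd; apply: (@le_trans _ _ (e * (q - p))); last by rewrite ler_wpM2l ?(ltW e0)//; lra.
        apply: bounded_derive_increment => //; first by apply: cF; [exact: le_trans cp|exact: le_trans db].
        move=> v /andP[pv vq]; exists (G v); first by apply: dF; apply/andP; split; lra.
        by apply: Gu; apply/andP; split; lra.
      by have [ut|/ltW tu] := leP u t; [rewrite distrC|]; apply: inc.
    have sub : K c d `<=` `[F t - e * (d - c), F t + e * (d - c)].
      move=> _ [u [/= + _] <-]; rewrite in_itv/= => /Fu.
      by rewrite in_itv/= ler_distl.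
    apply: (@le_trans _ _ (mu `[F t - e * (d - c), F t + e * (d - c)])).
      by apply: le_measure => //; rewrite inE; [exact: mK|exact: measurable_itv].
    rewrite lebesgue_measure_itv/= lte_fin; case: ifP => _.
      by rewrite -EFinB lee_fin; lra.
    by rewrite lee_fin !mulr_ge0// ?subr_ge0// ltW.
  move=> c m d ac cm md db Pc Pd.
  have sub : K c d `<=` K c m `|` K m d.
    move=> _ [t [tcd Gt] <-]; have [tm|tm] := leP t m; [left|right]; exists t => //; split => //;
    move: tcd; rewrite /= !in_itv/= => /andP[? ?]; apply/andP; split => //; exact: ltW.
  have m1 : measurable (K c m) by apply: mK => //; exact: le_trans db.
  have m2 : measurable (K m d) by apply: mK => //; exact: le_trans cm.
  apply: (@le_trans _ _ (mu (K c m `|` K m d))).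
    by apply: le_measure => //; rewrite inE; [apply: mK|exact: measurableU].
  apply: le_trans; first exact: measureU2.
  rewrite (_ : 2 * e * (d - c) = 2 * e * (m - c) + 2 * e * (d - m)); last by ring.
  by rewrite EFinD; exact: leeD.
apply/eqP; rewrite eq_le measure_ge0 andbT; apply/lee_addgt0Pr => e e0; rewrite add0e.
pose k := e / (2 * (b - a) + 1).
have k1 : 0 < 2 * (b - a) + 1 by lra.
have k0 : 0 < k by rewrite divr_gt0.
apply: le_trans (small k k0) _; rewrite lee_fin.
rewrite (_ : e = k * (2 * (b - a) + 1)); last by rewrite /k divfK// gt_eqF.
by clearbody k; lra.
Qed.

(** By the Lipschitz bound [C], a piece of duration [h] lies in a square of side [2 * C * h], whose
    area is at most [e * h] once [h < e / (4 * C ^+ 2)]. *)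
Lemma curve_image_null (X Y P Q : R -> R) (a b : R) : a <= b ->
  continuous P -> continuous Q ->
  (forall t, a <= t <= b -> is_derive t 1 X (P t)) ->
  (forall t, a <= t <= b -> is_derive t 1 Y (Q t)) ->
  let Z := (fun t => (X t, Y t)) @` `[a, b] : set plane in measurable Z /\ mu2 Z = 0%E.
Proof.
move=> ab cP cQ dX dY Z.
pose K c d := (fun t => (X t, Y t)) @` `[c, d] : set plane.
have [MP MP0 HP] := within_continuous_bounded ab (continuous_subspaceT cP).
have [MQ MQ0 HQ] := within_continuous_bounded ab (continuous_subspaceT cQ).
pose C := MP + MQ; have C0 : 0 < C by exact: addr_gt0.
have cX c d : a <= c -> d <= b -> {within `[c, d], continuous X}.
  move=> ac db; apply: continuous_in_subspaceT => t; rewrite inE/= in_itv/= => /andP[ct td].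
  by apply: (is_derive_continuous (dX t _)); rewrite (le_trans ac)//= (le_trans td).
have cY c d : a <= c -> d <= b -> {within `[c, d], continuous Y}.
  move=> ac db; apply: continuous_in_subspaceT => t; rewrite inE/= in_itv/= => /andP[ct td].
  by apply: (is_derive_continuous (dY t _)); rewrite (le_trans ac)//= (le_trans td).
have mK c d : a <= c -> d <= b -> measurable (K c d).
  move=> ac db; apply: measurable_compact_plane; apply: continuous_compact; last exact: segment_compact.
  by move=> t; exact: (cvg_pair (cX c d ac db t) (cY c d ac db t)).
split; first exact: mK.
have lip (F G : R -> R) p q : (forall c d, a <= c -> d <= b -> {within `[c, d], continuous F}) ->
    (forall t, a <= t <= b -> is_derive t 1 F (G t)) ->
    (forall t, a <= t <= b -> `|G t| <= C) ->
    a <= p -> p <= q -> q <= b -> `|F q - F p| <= C * (q - p).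
  move=> cF dF GC ap pq qb; apply: bounded_derive_increment => //; first exact: cF.
  by move=> t /andP[pt tq]; exists (G t); [apply: dF|apply: GC]; apply/andP; split; lra.
have PC t : a <= t <= b -> `|P t| <= C by move=> /HP/le_trans; apply; rewrite lerDl ltW.
have QC t : a <= t <= b -> `|Q t| <= C by move=> /HQ/le_trans; apply; rewrite lerDr ltW.
have small e : 0 < e -> (mu2 Z <= (e * (b - a))%:E)%E.
  move=> e0.
  apply: (@itv_creeping (fun c d => (mu2 (K c d) <= (e * (d - c))%:E)%E)) => //.
    move=> t tab; exists (e / (4 * C ^+ 2)); first by rewrite divr_gt0// mulr_gt0// exprn_gt0.
    move=> c d ac ct td db; rewrite ltr_pdivlMr ?mulr_gt0 ?exprn_gt0// => cde.
    have cd : c <= d by exact: le_trans td.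
    pose I (v : R) : set (measurableTypeR R) := `[v - C * (d - c), v + C * (d - c)]%classic.
    have sub : K c d `<=` I (X c) `*` I (Y c).
      move=> _ [u /= + <-]; rewrite in_itv/= => /andP[cu ud]; rewrite /I /= !in_itv/= -!ler_distl.
      have Cud : C * (u - c) <= C * (d - c) by rewrite ler_wpM2l ?(ltW C0)//; lra.
      split; (apply: le_trans Cud).
        by apply: (lip X P) => //; exact: le_trans db.
      by apply: (lip Y Q) => //; exact: le_trans db.
    apply: (@le_trans _ _ (mu2 (I (X c) `*` I (Y c)))).
      apply: le_measure => //; rewrite inE; first exact: mK.
      by apply: measurableX; exact: measurable_itv.
    rewrite plane_measureX; [|exact: measurable_itv|exact: measurable_itv].
    have muI v : mu (I v) = (2 * (C * (d - c)))%:E.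
      rewrite lebesgue_measure_itv/= lte_fin; case: ltP => h.
        by rewrite -EFinB; congr EFin; ring.
      have : 0 <= C * (d - c) by rewrite mulr_ge0 ?subr_ge0// ltW.
      by move=> h'; congr EFin; lra.
    rewrite !muI -EFinM lee_fin.
    have dc0 : 0 <= d - c by rewrite subr_ge0.
    have := ler_wpM2r dc0 (ltW cde); apply: le_trans.
    by rewrite le_eqVlt; apply/orP; left; apply/eqP; ring.
  move=> c m d ac cm md db Pc Pd.
  have sub : K c d `<=` K c m `|` K m d.
    move=> _ [t tcd <-]; have [tm|tm] := leP t m; [left|right]; exists t => //;
    move: tcd; rewrite /= !in_itv/= => /andP[? ?]; apply/andP; split => //; exact: ltW.
  have m1 : measurable (K c m) by apply: mK => //; exact: le_trans db.
  have m2 : measurable (K m d) by apply: mK => //; exact: le_trans cm.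
  apply: (@le_trans _ _ (mu2 (K c m `|` K m d))).
    by apply: le_measure => //; rewrite inE; [apply: mK|exact: measurableU].
  apply: le_trans; first exact: measureU2.
  rewrite (_ : e * (d - c) = e * (m - c) + e * (d - m)); last by ring.
  by rewrite EFinD; exact: leeD.
apply/eqP; rewrite eq_le measure_ge0 andbT; apply/lee_addgt0Pr => e e0; rewrite add0e.
have k1 : 0 < b - a + 1 by lra.
apply: le_trans (small (e / (b - a + 1)) _) _; first by rewrite divr_gt0.
rewrite lee_fin -[leRHS](divfK (lt0r_neq0 k1)) ler_wpM2l ?lerDl//.
by rewrite ltW// divr_gt0.
Qed.

End null_sets.

Section area.
Context {R : realType}.
Local Notation mu := (@lebesgue_measure R).
Local Notation mu2 := (@plane_measure R).
Local Notation plane := (measurableTypeR R * measurableTypeR R)%type.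
Variables (n : nat) (s : nat -> R) (x y : R -> R) (g : nat -> @plane_arc R).
Hypothesis sg : subdivided_curve n s x y g.

Lemma regular_values_ae : exists2 Z : set (measurableTypeR R), mu.-negligible Z &
  forall b, ~ Z b -> regular_value n s y g b.
Proof.
pose C i := arcy (g i) @` (`[s i, s i.+1] `&` [set t | arcdy (g i) t = 0]) `|`
  ([set y (s i)] `|` [set y (s i.+1)]) : set (measurableTypeR R).
exists (\bigcup_i (if (i < n)%N then C i else set0)).
  apply: negligible_bigcup => i; case: ifPn => ni; last exact: negligible_set0.
  have [/ltW si [[_ _ _ cQ] _ dY _ _]] := sg ni.
  have [mC C0] := critical_values_null si cQ dY.
  apply: negligibleU; first by apply/negligibleP.
  have set1_negligible v : mu.-negligible [set v].
    have mv : measurable ([set v] : set (measurableTypeR R)) by exact: measurable_set1.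
    by apply/negligibleP => //; exact: lebesgue_measure_set1.
  by apply: negligibleU; exact: set1_negligible.
move=> b Zb i t ni ti yt; have [_ [_ _ _ _ yE]] := sg ni.
have nC : ~ C i b by move=> Cb; apply: Zb; exists i => //; rewrite ni.
case/andP: (ti) => t1 t2; split.
  rewrite !lt_neqAle t1 t2 !andbT; apply/andP; split; apply/eqP => tE; apply: nC; right.
    by left; rewrite /= tE.
  by right; rewrite /= -tE.
apply/eqP => Q0; apply: nC; left; exists t; last by rewrite yE.
by split => //; rewrite /= in_itv.
Qed.

Lemma curve_negligible : (0 < n)%N -> mu2.-negligible [set z | ~ off_curve n s x y z].
Proof.
move=> n0; pose C i := (fun t => (arcx (g i) t, arcy (g i) t)) @` `[s i, s i.+1] : set plane.
have H : mu2.-negligible (\bigcup_i (if (i < n)%N then C i else set0)).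
  apply: negligible_bigcup => i; case: ifPn => ni; last exact: negligible_set0.
  have [/ltW si [[_ _ cP cQ] dX dY _ _]] := sg ni.
  by have [mC C0] := curve_image_null si cP cQ dX dY; apply/negligibleP.
apply: negligibleS H => z /= nz.
have [t [tn zt]] : exists t, s 0%N <= t <= s n /\ (x t, y t) = z.
  by apply: contrapT => h; apply: nz => t tn zt; apply: h; exists t.
have [i ni ti] := subdivision_cover n0 tn.
exists i => //; rewrite ni; exists t; first by rewrite /= in_itv.
by have [_ [_ _ _ xE yE]] := sg ni; rewrite xE// yE.
Qed.

Hypothesis closed_curve : (x (s n), y (s n)) = (x (s 0%N), y (s 0%N)).
Variable Omega : set (R * R).
Hypothesis Omega_open : open Omega.
Hypothesis Omega_connected : connected Omega.
Hypothesis Omega_boundary : forall z, closure Omega z /\ ~ Omega z <->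
  exists2 t, s 0%N <= t <= s n & (x t, y t) = z.
Hypothesis curve_simple : forall i t t0, (i < n)%N -> s i < t0 < s i.+1 ->
  s 0%N <= t <= s n -> (x t, y t) = (x t0, y t0) -> t = t0.
Hypothesis Omega_left : forall i t, (i < n)%N -> s i < t < s i.+1 ->
  arcdy (g i) t != 0 -> exists2 r, 0 < r & forall e, 0 < e < r ->
    Omega (x t - e * arcdy (g i) t, y t + e * arcdx (g i) t).
Variable M : R.
Hypothesis Omega_bounded : forall z, Omega z -> `|z.1| <= M /\ `|z.2| <= M.
Hypothesis curve_bounded : forall t, s 0%N <= t <= s n -> `|x t| <= M /\ `|y t| <= M.

Lemma area_line_integral : (0 < n)%N -> area Omega = line_integral n s g.
Proof.
move=> n0; have [W [iW eW WE]] := integral_winding sg closed_curve curve_bounded.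
have mO : measurable (Omega : set plane) by exact: measurable_open_plane.
have [Z0 [Z [mZ muZ Z0Z]] Zreg] := regular_values_ae.
(* Exceptional points lie on horizontal lines of nonregular height, a null set by Sard, or on the
   curve. *)
have Wae : {ae mu2, forall z, box M z -> W z = (\1_Omega z)%:E}.
  have NZ : mu2.-negligible ((setT : set (measurableTypeR R)) `*` Z).
    have mTZ : measurable ((setT : set (measurableTypeR R)) `*` Z) by exact: measurableX.
    apply/negligibleP => //.
    by apply: etrans (plane_measureX measurableT mZ) _; rewrite muZ mule0.
  apply: negligibleS (negligibleU NZ (curve_negligible n0)) => z /= nz.
  have [Zz|Zz] := pselect (Z z.2); [by left|right => oz; apply: nz => _].
  rewrite WE//; congr EFin; case: z Zz oz {WE} => a b /= Zb oab.
  apply: (winding_indicator sg closed_curve Omega_open Omega_connected Omega_boundary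
    curve_simple Omega_left (M := M)) => //.
  - by move=> z /Omega_bounded[h _]; apply: le_trans h; exact: ler_norm.
  - by move=> t /curve_bounded[h _]; apply: le_trans h; exact: ler_norm.
  - by apply: Zreg => /Z0Z.
have mB := @measurable_box R M.
have OB : Omega `<=` box M.
  move=> z Oz; have [h1 h2] := Omega_bounded Oz; rewrite /box /= !in_itv/= -!ler_norml.
  by split => //; have := normr_ge0 z.1; lra.
have e1 : (\int[mu2]_(z in box M) W z = \int[mu2]_(z in box M) (\1_Omega z)%:E)%E.
  apply: ae_eq_integral => //; first exact: measurable_int iW.
  by apply/measurable_EFinP; apply: measurable_indic.
by rewrite /area -[LHS]/(fine (mu2 Omega)) -(setIidl OB) -integral_indic// -e1 eW.
Qed.

End area.

(** * Asymptotics of the planimeter *)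

Section trigonometric_bounds.
Context {R : realType}.
Implicit Types a b : R.

Let increment (f df : R -> R) (K : R) a b :
  (forall u : R, is_derive u 1 f (df u)) ->
  (forall u, `|u - b| <= `|a - b| -> `|df u| <= K) ->
  `|f a - f b| <= K * `|a - b|.
Proof.
move=> d dK; have cf c e : {within `[c, e], continuous f}.
  by apply: continuous_subspaceT => u; exact: is_derive_continuous (d u).
have [ab|/ltW ba] := leP a b.
  rewrite distrC (distrC a) (ger0_norm (_ : 0 <= b - a)) ?subr_ge0//.
  apply: bounded_derive_increment => // u /andP[au ub]; exists (df u) => //.
  by apply: dK; rewrite distrC (distrC a) !ger0_norm ?subr_ge0 ?ltW//; lra.
rewrite (ger0_norm (_ : 0 <= a - b)) ?subr_ge0//.
apply: bounded_derive_increment => // u /andP[bu ua]; exists (df u) => //.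
by apply: dK; rewrite !ger0_norm ?subr_ge0 ?ltW//; lra.
Qed.

Lemma sin_lipschitz a b : `|sin a - sin b| <= `|a - b|.
Proof.
rewrite -[leRHS]mul1r; apply: (increment (f := sin) (df := cos)) => u _.
exact: cos_max.
Qed.

Lemma cos_lipschitz a b : `|cos a - cos b| <= `|a - b|.
Proof.
rewrite -[leRHS]mul1r; apply: (increment (f := cos) (df := fun u => - sin u)) => u _.
by rewrite normrN; exact: sin_max.
Qed.

(** Mean value bound for [sin u - cos b * u], whose derivative is controlled by the Lipschitz bound
    of the cosine; this gives the constant 1 instead of the sharp 1/2. *)
Lemma sin_taylor a b : `|sin a - sin b - cos b * (a - b)| <= (a - b) ^+ 2.
Proof.
rewrite -real_normK ?num_real// expr2.
rewrite (_ : sin a - _ - _ = (sin a - cos b * a) - (sin b - cos b * b)); last by ring.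
apply: (increment (f := fun u => sin u - cos b * u) (df := fun u => cos u - cos b)) => u.
  have d : is_derive u 1 (fun v : R => cos b * v) (cos b).
    by apply: is_derive_eq; rewrite /GRing.scale/= mulr1.
  exact: is_deriveB (is_derive_sin u) d.
by move=> uab; apply: le_trans (cos_lipschitz _ _) _.
Qed.

Lemma cos_taylor a b : `|cos a - cos b + sin b * (a - b)| <= (a - b) ^+ 2.
Proof.
rewrite -real_normK ?num_real// expr2.
rewrite (_ : cos a - _ + _ = (cos a + sin b * a) - (cos b + sin b * b)); last by ring.
apply: (increment (f := fun u => cos u + sin b * u) (df := fun u => - (sin u - sin b))) => u.
  have d : is_derive u 1 (fun v : R => sin b * v) (sin b).
    by apply: is_derive_eq; rewrite /GRing.scale/= mulr1.
  by apply: (is_derive_eq (is_deriveD (is_derive_cos u) d)); ring.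
by move=> uab; rewrite normrN; apply: le_trans (sin_lipschitz _ _) _.
Qed.

End trigonometric_bounds.

Section prytz.
Context {R : realType}.
Variables (n : nat) (s : nat -> R) (x y : R -> R) (g : nat -> @plane_arc R).
Hypothesis sg : subdivided_curve n s x y g.

Lemma uniform_bound (m : nat) (P : nat -> R -> Prop) :
  (forall i B B', P i B -> B <= B' -> P i B') ->
  (forall i, (i < m)%N -> exists B, P i B) ->
  exists2 B, 0 < B & forall i, (i < m)%N -> P i B.
Proof.
move=> hP; elim: m => [|m IH] H; first by exists 1.
have [|B B0 HB] := IH; first by move=> i im; apply: H; exact: ltnW.
have [B' HB'] := H m (ltnSn m).
exists (Num.max B B'); first by rewrite lt_max B0.
move=> i; rewrite ltnS leq_eqVlt => /predU1P[->|im].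
  by apply: hP HB' _; rewrite le_max lexx orbT.
by apply: hP (HB i im) _; rewrite le_max lexx.
Qed.

Lemma curve_speed_bound : exists2 B, 0 < B & forall i, (i < n)%N ->
  forall t, s i <= t <= s i.+1 -> `|arcdx (g i) t| <= B /\ `|arcdy (g i) t| <= B.
Proof.
apply: uniform_bound => [i B B' H BB' t ti|i ni].
  by have [h1 h2] := H t ti; split; exact: le_trans BB'.
have [/ltW si [[_ _ cP cQ] _ _ _ _]] := sg ni.
have [M M0 HM] := within_continuous_bounded si (continuous_subspaceT cP).
have [N N0 HN] := within_continuous_bounded si (continuous_subspaceT cQ).
exists (Num.max M N) => t ti; split.
  by apply: le_trans (HM t ti) _; rewrite le_max lexx.
by apply: le_trans (HN t ti) _; rewrite le_max lexx orbT.
Qed.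

Lemma subdivided_increment (f : R -> R) (K : R) :
  {within `[s 0%N, s n], continuous f} ->
  (forall i t, (i < n)%N -> s i < t < s i.+1 -> exists2 d, is_derive t 1 f d & `|d| <= K) ->
  forall t, s 0%N <= t <= s n -> `|f t - f (s 0%N)| <= K * (t - s 0%N).
Proof.
move=> cf df t; suff H m : (m <= n)%N -> forall t, s 0%N <= t <= s m ->
    `|f t - f (s 0%N)| <= K * (t - s 0%N) by exact: H.
elim: m => [_ u|m IH mn u /andP[u0 um]].
  by rewrite -eq_le => /eqP <-; rewrite !subrr normr0 mulr0.
have [ums|/ltW smu] := leP u (s m); first by apply: IH; [exact: ltnW|rewrite u0].
have s0m : s 0%N <= s m by apply: (subdivision_mono sg); rewrite /= ltnW.
have smn : s m.+1 <= s n by apply: (subdivision_mono sg); rewrite mn leqnn.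
have h1 : `|f (s m) - f (s 0%N)| <= K * (s m - s 0%N).
  by apply: IH; [exact: ltnW|rewrite s0m lexx].
have h2 : `|f u - f (s m)| <= K * (u - s m).
  apply: bounded_derive_increment => //.
    by apply: continuous_subspaceW cf; apply: subset_itv; rewrite bnd_simp// (le_trans um).
  by move=> v /andP[mv vu]; apply: (df m) => //; rewrite mv (lt_le_trans vu).
rewrite (_ : f u - _ = (f u - f (s m)) + (f (s m) - f (s 0%N))); last by ring.
by apply: le_trans (ler_normD _ _) _; lra.
Qed.

Lemma curve_derive i t : (i < n)%N -> s i < t < s i.+1 ->
  is_derive t 1 x (arcdx (g i) t) /\ is_derive t 1 y (arcdy (g i) t).
Proof.
move=> ni /andP[t1 t2]; have [_ [_ dX dY xE yE]] := sg ni.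
have ti : s i <= t <= s i.+1 by rewrite !ltW.
have r0 : 0 < Num.min (t - s i) (s i.+1 - t) by rewrite lt_min !subr_gt0 t1.
have near u : `|u - t| < Num.min (t - s i) (s i.+1 - t) -> s i <= u <= s i.+1.
  by rewrite lt_min !ltr_norml => /andP[/andP[? ?] /andP[? ?]]; apply/andP; split; lra.
split.
  by apply: is_derive_local r0 _ (dX t ti) => u /near /xE.
by apply: is_derive_local r0 _ (dY t ti) => u /near /yE.
Qed.

Hypothesis x_continuous : {within `[s 0%N, s n], continuous x}.
Hypothesis y_continuous : {within `[s 0%N, s n], continuous y}.
Hypothesis x0 : x (s 0%N) = 0.
Hypothesis y0 : y (s 0%N) = 0.
Hypothesis xn : x (s n) = 0.
Hypothesis yn : y (s n) = 0.

(* With [K = cos theta0] and [S = sin theta0], the second order term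
   [(K dx + S dy) (S x - K y)] is an exact form plus [x dy]. *)
Lemma prytz_expansion (theta0 : R) : exists2 C, 0 <= C & forall l theta, 0 < l ->
  {within `[s 0%N, s n], continuous theta} -> theta (s 0%N) = theta0 ->
  (forall i t, (i < n)%N -> s i < t < s i.+1 -> is_derive t 1 theta
    (l^-1 * (sin (theta t) * arcdx (g i) t - cos (theta t) * arcdy (g i) t))) ->
  `|theta (s n) - theta0 - line_integral n s g / l ^+ 2| <= C / l ^+ 3.
Proof.
have [D D0 HD] := curve_speed_bound.
have s0n : s 0%N <= s n by apply: (subdivision_mono sg); rewrite leqnn.
(* [D] bounds both velocity components and [L] is the duration. [C1] will bound the zeroth order
   error of the heading in units of [1 / l], and [C2] the first order error [a] in units of
   [1 / l ^+ 2]. *)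
pose L := s n - s 0%N; have L0 : 0 <= L by rewrite subr_ge0.
pose C1 := 2 * D * L; have C10 : 0 <= C1 by rewrite !mulr_ge0// ltW.
pose C2 := 2 * D * C1 * L; have C20 : 0 <= C2 by rewrite !mulr_ge0// ltW.
exists (2 * D * (C1 ^+ 2 + C2) * L).
  by rewrite mulr_ge0// mulr_ge0 ?addr_ge0 ?sqr_ge0// mulr_ge0// ltW.
move=> l theta l0 ct t0 dt; pose h := l^-1; have h0 : 0 < h by rewrite invr_gt0.
pose S := sin theta0; pose K := cos theta0.
have incl i t : (i < n)%N -> s i < t < s i.+1 -> s i <= t <= s i.+1.
  by move=> _ /andP[? ?]; rewrite !ltW.
have theta_bound t : s 0%N <= t <= s n -> `|theta t - theta0| <= C1 * h.
  move=> tn; rewrite -t0; apply: le_trans (_ : h * (2 * D) * (t - s 0%N) <= _).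
    apply: (subdivided_increment ct) => // i u ni ui.
    exists (h * (sin (theta u) * arcdx (g i) u - cos (theta u) * arcdy (g i) u)); first exact: dt.
    have [P Q] := HD i ni u (incl i u ni ui).
    rewrite normrM (gtr0_norm h0) ler_pM2l//; apply: le_trans (ler_normB _ _) _.
    rewrite !normrM mulr_natl mulr2n; apply: lerD; rewrite -[leRHS]mul1r ler_pM//.
      exact: sin_max.
    exact: cos_max.
  rewrite (_ : C1 * h = h * (2 * D) * L); last by rewrite /C1; ring.
  rewrite ler_wpM2l//; last by rewrite /L lerD2r; case/andP: tn.
  by rewrite mulr_ge0 ?(ltW h0)// mulr_ge0// ltW.
(* The subtracted first order term comes from freezing the heading at [theta0] in the equation. *)
pose a t := theta t - theta0 - h * (S * x t - K * y t).
have mulD (p q v w P Q : R) : `|p| <= v -> `|q| <= w -> `|P| <= D -> `|Q| <= D ->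
    `|p * P + q * Q| <= (v + w) * D.
  move=> pv qw PD QD; rewrite mulrDl; apply: le_trans (ler_normD _ _) _.
  by rewrite !normrM; apply: lerD; exact: ler_pM.
have da i t : (i < n)%N -> s i < t < s i.+1 -> is_derive t 1 a
    (h * ((sin (theta t) - S) * arcdx (g i) t + (K - cos (theta t)) * arcdy (g i) t)).
  move=> ni ti; have [dx dy] := curve_derive ni ti; have d1 := dt i t ni ti.
  have d2 := is_deriveB (is_deriveB d1 (is_derive_cst theta0 t 1))
    (is_deriveZ h (is_deriveB (is_deriveZ S dx) (is_deriveZ K dy))).
  by apply: (is_derive_eq d2); rewrite /GRing.scale/= -/h; ring.
have ca : {within `[s 0%N, s n], continuous a}.
  move=> t; apply: cvgB; first by apply: cvgB; [exact: ct|exact: cvg_cst].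
  apply: cvgM; first exact: cvg_cst.
  apply: cvgB; apply: cvgM; try exact: cvg_cst; [exact: x_continuous|exact: y_continuous].
have a_bound t : s 0%N <= t <= s n -> `|a t| <= C2 * h ^+ 2.
  move=> tn; have a0 : a (s 0%N) = 0 by rewrite /a t0 x0 y0 !mulr0 !subrr mulr0 subr0.
  rewrite -[a t]subr0 -a0; apply: le_trans (_ : h * (2 * D * (C1 * h)) * (t - s 0%N) <= _).
    apply: (subdivided_increment ca) => // i u ni ui; eexists; first exact: (da i u ni ui).
    have un := subdivision_itv sg ni (incl i u ni ui).
    have [P Q] := HD i ni u (incl i u ni ui).
    rewrite normrM (gtr0_norm h0) ler_pM2l//.
    rewrite (_ : 2 * D * (C1 * h) = (C1 * h + C1 * h) * D); last by ring.
    apply: mulD => //.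
      by apply: le_trans (sin_lipschitz _ _) _; exact: theta_bound.
    by rewrite distrC; apply: le_trans (cos_lipschitz _ _) _; exact: theta_bound.
  rewrite (_ : C2 * h ^+ 2 = h * (2 * D * (C1 * h)) * L); last by rewrite /C2; ring.
  rewrite ler_wpM2l//; last by rewrite /L lerD2r; case/andP: tn.
  by rewrite mulr_ge0 ?(ltW h0)// mulr_ge0 ?mulr_ge0 ?(ltW h0)// ltW.
pose E := 2 * D * (C1 ^+ 2 + C2) * h ^+ 3.
have F i : exists F : R -> R, (i < n)%N -> forall t, s i <= t <= s i.+1 ->
    is_derive t 1 F (arcx (g i) t * arcdy (g i) t).
  have [ni|ni] := ltnP i n; last by exists id.
  have [/ltW si [[cX _ _ cQ] _ _ _ _]] := sg ni.
  have [|F _ dF] := @continuous_primitive R (fun t => arcx (g i) t * arcdy (g i) t) _ _ si.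
    by move=> t; apply: cvgM; [exact: cX|exact: cQ].
  by exists F.
have [F' dF] := choice F.
(* The heading minus its first and second order terms. Its derivative is [h] times the Taylor errors
   of sine and cosine, quadratic in [theta - theta0], plus [h] times [a]: both are of order
   [h ^+ 3]. [F'] is known only up to a constant on each piece, so only increments of [B i] within a
   piece matter. *)
pose B i t := theta t - h * (S * x t - K * y t) -
  h ^+ 2 * (K * S / 2 * (x t ^+ 2 - y t ^+ 2) - K ^+ 2 * (x t * y t) + F' i t).
have dB i t : (i < n)%N -> s i < t < s i.+1 -> is_derive t 1 (B i)
    (h * ((sin (theta t) - S - K * (theta t - theta0)) * arcdx (g i) t +
          - (cos (theta t) - K + S * (theta t - theta0)) * arcdy (g i) t) +
     h * (K * a t * arcdx (g i) t + S * a t * arcdy (g i) t)).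
  move=> ni ti; have [dx dy] := curve_derive ni ti; have d1 := dt i t ni ti.
  have dFi := dF i ni t (incl i t ni ti).
  have [_ [_ _ _ xE _]] := sg ni; rewrite xE in dFi; last exact: incl ti.
  have d2 := is_deriveB (is_deriveB d1
    (is_deriveZ h (is_deriveB (is_deriveZ S dx) (is_deriveZ K dy))))
    (is_deriveZ (h ^+ 2) (is_deriveD (is_deriveB
      (is_deriveZ (K * S / 2) (is_deriveB (is_deriveM dx dx) (is_deriveM dy dy)))
      (is_deriveZ (K ^+ 2) (is_deriveM dx dy))) dFi)).
  refine (@is_derive_local R (B i) _ t _ 1 ltr01 _ (is_derive_eq d2 _)).
    by move=> u _; rewrite /B !expr2.
  (* The mixed terms are [S ^+ 2 * x dy - K ^+ 2 * y dx], that is, minus [K ^+ 2 * d(x y)] plus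
     [(K ^+ 2 + S ^+ 2) * x dy]. *)
  have e : h ^+ 2 * (x t * arcdy (g i) t) * (K ^+ 2 + S ^+ 2) = h ^+ 2 * (x t * arcdy (g i) t).
    by rewrite cos2Dsin2 mulr1.
  by rewrite /a /GRing.scale/= -/h -/S -/K; clearbody h S K; lra.
have B_increment i : (i < n)%N -> `|B i (s i.+1) - B i (s i)| <= E * (s i.+1 - s i).
  move=> ni; have [/ltW si _] := sg ni.
  have sub : `[s i, s i.+1] `<=` `[s 0%N, s n].
    by move=> u; rewrite /= !in_itv/= => ui; exact: (subdivision_itv sg ni ui).
  have cx := continuous_subspaceW sub x_continuous.
  have cy := continuous_subspaceW sub y_continuous.
  have cF : {within `[s i, s i.+1], continuous (F' i)}.
    apply: continuous_in_subspaceT => u; rewrite inE/= in_itv/= => ui.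
    exact: is_derive_continuous (dF i ni u ui).
  apply: bounded_derive_increment => // [u|u ui].
    apply: cvgB.
      apply: cvgB; first exact: (continuous_subspaceW sub ct).
      apply: cvgM; first exact: cvg_cst.
      apply: cvgB; apply: cvgM; try exact: cvg_cst; [exact: cx|exact: cy].
    apply: cvgM; first exact: cvg_cst.
    apply: cvgD; last exact: cF.
    apply: cvgB; (apply: cvgM; first exact: cvg_cst).
      by apply: cvgB; apply: cvgM; (exact: cx || exact: cy).
    by apply: cvgM; [exact: cx|exact: cy].
  eexists; first exact: (dB i u ni ui).
  have un := subdivision_itv sg ni (incl i u ni ui).
  have [P Q] := HD i ni u (incl i u ni ui).
  have th2 : (theta u - theta0) ^+ 2 <= (C1 * h) ^+ 2.
    by rewrite -real_normK ?num_real// ler_pXn2r ?nnegrE// ?theta_bound// mulr_ge0// ltW.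
  rewrite (_ : E = h * (((C1 * h) ^+ 2 + (C1 * h) ^+ 2) * D) +
    h * ((C2 * h ^+ 2 + C2 * h ^+ 2) * D)); last by rewrite /E; ring.
  apply: le_trans (ler_normD _ _) _; rewrite !normrM (gtr0_norm h0).
  apply: lerD; rewrite ler_pM2l//; apply: mulD => //.
  - exact: le_trans (sin_taylor _ _) th2.
  - by rewrite normrN; exact: le_trans (cos_taylor _ _) th2.
  - rewrite normrM -[leRHS]mul1r; apply: ler_pM => //; [exact: cos_max|exact: a_bound].
  - rewrite normrM -[leRHS]mul1r; apply: ler_pM => //; [exact: sin_max|exact: a_bound].
have line : line_integral n s g = \sum_(i < n) (F' i (s i.+1) - F' i (s i)).
  apply: eq_bigr => -[i /= ni] _; have [/ltW si [[cX _ _ cQ] _ _ _ _]] := sg ni.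
  apply: Rintegral_derive => //; last exact: dF.
  by apply: continuous_subspaceT => t; apply: cvgM; [exact: cX|exact: cQ].
(* The part of [B i] common to all pieces, which telescopes; the increments of [F'] add up to the
   line integral. *)
pose Psi t := theta t - h * (S * x t - K * y t) -
  h ^+ 2 * (K * S / 2 * (x t ^+ 2 - y t ^+ 2) - K ^+ 2 * (x t * y t)).
have sumE : theta (s n) - theta0 - line_integral n s g / l ^+ 2 =
    \sum_(i < n) (B i (s i.+1) - B i (s i)).
  transitivity (\sum_(i < n) ((Psi (s i.+1) - Psi (s i)) -
      h ^+ 2 * (F' i (s i.+1) - F' i (s i)))); last first.
    by apply: eq_bigr => i _; rewrite /B /Psi; ring.
  rewrite sumrB -mulr_sumr -line -(big_mkord xpredT (fun i => Psi (s i.+1) - Psi (s i))).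
  rewrite telescope_sumr// /Psi xn yn x0 y0 t0 /h exprVn; ring.
rewrite sumE; apply: le_trans (ler_norm_sum _ _ _) _.
apply: (@le_trans _ _ (\sum_(i < n) E * (s i.+1 - s i))).
  by apply: ler_sum => i _; exact: B_increment.
rewrite -mulr_sumr -(big_mkord xpredT (fun i => s i.+1 - s i)) telescope_sumr//.
by rewrite le_eqVlt /E /h -exprVn; apply/orP; left; apply/eqP; rewrite /L; ring.
Qed.

End prytz.

(** * From the hypotheses of the theorem to the expansion *)

Lemma piecewise_C1_continuous (R : realType) (a b : R) (f : R -> R) :
  piecewise_C1 a b f -> {within `[a, b], continuous f}.
Proof.
move=> [n [s [<- <- si Hs]]].
suff H m : (m <= n)%N -> s 0%N <= s m /\ {within `[s 0%N, s m], continuous f} by have [] := H n (leqnn n).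
elim: m => [_|m IH mn]; first by split => //; rewrite set_itv1; exact: continuous_subspace1.
have [s0m cm] := IH (ltnW mn); have sm := ltW (si m mn).
split; first exact: le_trans sm.
have -> : `[s 0%N, s m.+1]%classic = `[s 0%N, s m] `|` `[s m, s m.+1].
  apply/seteqP; split=> t /=; rewrite !in_itv/=.
    by move=> /andP[t0 t1]; have [tm|/ltW tm] := leP t (s m); [left|right]; apply/andP.
  by move=> [|] /andP[h1 h2]; rewrite ?h1 ?h2 ?(le_trans h2)// (le_trans s0m).
apply: withinU_continuous => //; try exact: interval_closed.
by have [] := Hs m mn.
Qed.

Lemma bounded_set_norm_le (R : realType) (A : set (R * R)) : bounded_set A ->
  exists M, forall z, A z -> `|z.1| <= M /\ `|z.2| <= M.
Proof.
move=> [M [_ HM]]; exists (M + 1) => z Az.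
have : `|z| <= M + 1 by apply: HM => //; rewrite ltrDl.
by rewrite prod_normE/= ge_max => /andP[].
Qed.
Theorem mainTheorem1 (R : realType) (Omega1 : set (R * R)) (T : R)
    (x y : R -> R) (theta0 : R) (theta : R -> R -> R)
    (Omega1_region : region Omega1)
    (Omega1_bounded : bounded_set Omega1)
    (Omega1_simply_connected : simply_connected Omega1)
    (T_gt0 : 0 < T)
    (gamma_curve : piecewise_smooth_simple_closed T x y)
    (gamma_base : curve x y 0 = (0, 0))
    (gamma_boundary : boundary Omega1 = curve x y @` `[0, T])
    (gamma_positive : positively_oriented T x y Omega1)
    (theta_sol : forall l, 0 < l -> prytz_solution T x y theta0 l (theta l)) :
  let A := area Omega1 in
  let Dtheta := fun l => theta l T - theta l 0 in
  Dtheta = (fun l => A / l ^+ 2) +O_+oo (fun l => (l ^+ 3)^-1) /\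
  (fun=> A) = (fun l => l ^+ 2 * Dtheta l) +O_+oo (fun l => l^-1).
Proof.
have [x_C1 y_C1 closed simple] := gamma_curve.
have [n [s [g [s0 sn sg]]]] := subdivided_curve_exists x_C1 y_C1.
have n0 : (0 < n)%N.
  by rewrite lt0n; apply/eqP => n0; move: T_gt0; rewrite -sn n0 s0 ltxx.
case: Omega1_region => Oo Oc [z0 Oz0].
have [x0 y0] : x 0 = 0 /\ y 0 = 0 by case: gamma_base.
have [xT yT] : x T = 0 /\ y T = 0 by case: closed; rewrite x0 y0.
have closed' : (x (s n), y (s n)) = (x (s 0%N), y (s 0%N)) by rewrite s0 sn x0 y0 xT yT.
have in0T i t : (i < n)%N -> s i < t < s i.+1 -> 0 < t < T.
  move=> ni /andP[t1 t2]; rewrite -s0 -sn; apply/andP; split.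
    by apply: le_lt_trans t1; apply: (subdivision_mono sg); rewrite /= ltnW.
  by apply: lt_le_trans t2 _; apply: (subdivision_mono sg); rewrite ni leqnn.
have derE (f : R -> R) (t d : R) : is_derive t 1 f d -> derivable f t 1 /\ derive1 f t = d.
  by move=> [df <-]; rewrite derive1E.
have bnd z : closure Omega1 z /\ ~ Omega1 z <->
    exists2 t, s 0%N <= t <= s n & (x t, y t) = z.
  have : boundary Omega1 z <-> (curve x y @` `[0, T]) z by rewrite gamma_boundary.
  rewrite /boundary (interior_id _).1 // s0 sn => -[h1 h2]; split.
    by move=> h; have [t] := h1 h; rewrite /= in_itv/= => tT <-; exists t.
  by move=> [t tT zt]; apply: h2; exists t => //=; rewrite in_itv.
have simple' i t t0 : (i < n)%N -> s i < t0 < s i.+1 -> s 0%N <= t <= s n ->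
    (x t, y t) = (x t0, y t0) -> t = t0.
  rewrite s0 sn => ni ti /andP[t0' tT] e; have /andP[h1 h2] := in0T i t0 ni ti.
  have t0T : 0 <= t0 < T by rewrite h2 ltW.
  (* Simplicity is given on the half-open interval only. At [t = T] the curve is back at its value
     at time 0, which would force the positive time [t0] to be 0. *)
  have [tT'|Tt] := ltP t T; first by apply: simple => //; rewrite t0'.
  have tE : t = T by apply/eqP; rewrite eq_le tT.
  have : 0 = t0 by apply: simple => //; rewrite ?lexx// closed /curve -e tE.
  by move=> t00; move: h1; rewrite -t00 ltxx.
have left i t : (i < n)%N -> s i < t < s i.+1 -> arcdy (g i) t != 0 ->
    exists2 r, 0 < r & forall e, 0 < e < r ->
      Omega1 (x t - e * arcdy (g i) t, y t + e * arcdx (g i) t).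
  move=> ni ti Q0; have [dx dy] := curve_derive sg ni ti.
  have [xd xE] := derE _ _ _ dx; have [yd yE] := derE _ _ _ dy.
  have := gamma_positive t (in0T i t ni ti) xd yd; rewrite xE yE => -[].
    by apply/eqP => -[_ /eqP]; rewrite (negbTE Q0).
  move=> r /= r0 Hr; exists r => // e /andP[e0 er]; apply: Hr => //=.
  by rewrite sub0r normrN gtr0_norm.
have [M0 HM0] := bounded_set_norm_le Omega1_bounded.
have x_cont : {within `[s 0%N, s n], continuous x} by rewrite s0 sn; exact: piecewise_C1_continuous.
have y_cont : {within `[s 0%N, s n], continuous y} by rewrite s0 sn; exact: piecewise_C1_continuous.
have s0n : s 0%N <= s n by rewrite s0 sn ltW.
have [Mx _ HMx] := within_continuous_bounded s0n x_cont.
have [My _ HMy] := within_continuous_bounded s0n y_cont.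
pose M := Num.max M0 (Num.max Mx My).
have HO z : Omega1 z -> `|z.1| <= M /\ `|z.2| <= M.
  by move=> /HM0[h1 h2]; rewrite /M !le_max h1 h2.
have HC t : s 0%N <= t <= s n -> `|x t| <= M /\ `|y t| <= M.
  by move=> tn; rewrite /M !le_max HMx// HMy// !orbT.
have AE : area Omega1 = line_integral n s g.
  exact: (area_line_integral sg closed' Oo Oc bnd simple' left HO HC n0).
rewrite -sn in xT yT.
have x0' : x (s 0%N) = 0 by rewrite s0.
have y0' : y (s 0%N) = 0 by rewrite s0.
have [C C0 HC'] := prytz_expansion sg x_cont y_cont x0' y0' xT yT theta0.
move=> A Dtheta.
have main l : 0 < l -> `|Dtheta l - A / l ^+ 2| <= C / l ^+ 3.
  move=> l0; have [th_C1 th0 th_ode] := theta_sol l l0.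
  rewrite /Dtheta /A AE th0 -sn; apply: HC' => //.
  - by rewrite s0 sn; exact: piecewise_C1_continuous.
  - by rewrite s0.
  move=> i t ni ti; have [dx dy] := curve_derive sg ni ti.
  have [xd xE] := derE _ _ _ dx; have [yd yE] := derE _ _ _ dy.
  by have := th_ode t (in0T i t ni ti) xd yd; rewrite xE yE.
(* Any [k >= C] is a Landau constant for both claims; the second estimate is the first multiplied by
   [l ^+ 2]. *)
split; apply/eqaddOP; near=> k; near=> l; have l0 : 0 < l by near: l; exact: nbhs_pinfty_gt.
- rewrite !fctE; apply: le_trans (main l l0) _.
  rewrite ger0_norm ?invr_ge0 ?exprn_ge0 ?(ltW l0)//.
  by rewrite ler_wpM2r ?invr_ge0 ?exprn_ge0 ?(ltW l0)//; near: k; exact: nbhs_pinfty_ge.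
- rewrite !fctE (_ : A - _ = - (l ^+ 2 * (Dtheta l - A / l ^+ 2))); last first.
    by field; rewrite gt_eqF.
  rewrite normrN normrM (ger0_norm (sqr_ge0 l)) (@gtr0_norm _ l^-1) ?invr_gt0//.
  apply: (@le_trans _ _ (C / l)).
    rewrite (_ : C / l = l ^+ 2 * (C / l ^+ 3)); last by field; rewrite gt_eqF.
    by rewrite ler_wpM2l ?sqr_ge0// main.
  by rewrite ler_wpM2r ?invr_ge0 ?(ltW l0)//; near: k; exact: nbhs_pinfty_ge.
Unshelve. all: by end_near. Qed.
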